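(* Let $n\ge 1$, let $f:\{0,1\}^n\to\{0,1\}^n$ be a Boolean function with associated Boolean system $\mathbb{B}=(\{0,1\}^n,f)$, let $\mathcal{Q}$ be a conversion scheme, and let $\vec{\gamma}^{\,-}=(\gamma_1,\dots,\gamma_n)$ be a fixed vector of positive reals. Then there exist $\mu>0$ and nonempty open sets $U^s\subset W^s$ for $s\in\{0,1\}^n$ such that for every extension of $\vec{\gamma}^{\,-}$ to a $2n$-dimensional vector $\vec{\gamma}=(\gamma_1,\dots,\gamma_{2n})$ of positive reals with $\gamma_{i+n}<\mu$ for all $i\in\{1,\dots,n\}$, the following holds for the flow $\mathbb{D}_2(f,\vec{\gamma},\mathcal{Q})$: (i) For every $s\in\{0,1\}^n$ whose trajectory in $\mathbb{B}$ is monotone-stepping, the flow $\mathbb{D}_2(f,\vec{\gamma},\mathcal{Q})$ is consistent with $\mathbb{B}$ on $U^s$. (ii) For every $s\in\{0,1\}^n$ whose trajectory in $\mathbb{B}$ is one-stepping, the flow $\mathbb{D}_2(f,\vec{\gamma},\mathcal{Q})$ is strongly consistent with $\mathbb{B}$ on $U^s$. (iii) If $\mathbb{B}$ is monotone-stepping, then the flow $\mathbb{D}_2(f,\vec{\gamma},\mathcal{Q})$ is consistent with $\mathbb{B}$. (iv) If $\mathbb{B}$ is one-stepping, then the flow $\mathbb{D}_2(f,\vec{\gamma},\mathcal{Q})$ is strongly consistent with $\mathbb{B}$.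
   Context: Notation: $[n]=\{1,\dots,n\}$. Boolean systems. A Boolean system $\mathbb{B}=(\{0,1\}^n,f)$ has dynamics $\vec{s}(\tau+1)=f(\vec{s}(\tau))$, $\tau=0,1,2,\dots$; the trajectory of $\vec{s}=\vec{s}(0)$ is $\{\vec{s}(\tau)\}_{\tau\ge 0}$ with $\vec{s}(\tau)=f^\tau(\vec{s}(0))$. A fixed point is a state $s$ with $f(s)=s$. $H(\vec{s},\vec{s}^{\,*})$ is the Hamming distance (number of indices $i$ with $s_i\ne s_i^*$). A trajectory is one-stepping if $H(\vec{s}(\tau),\vec{s}(\tau+1))\le 1$ for all $\tau$. For states $\vec{s},\vec{s}^{\,*}$ write $\vec{s}\preceq\vec{s}^{\,*}\prec f(\vec{s})$ if $s_i=s_i^*$ for all $i$ with $s_i=f(\vec{s})_i$, and $\vec{s}^{\,*}\ne f(\vec{s})$. A trajectory is monotone-stepping if for all $\tau$ and all $\vec{s}^{\,*}$: $\vec{s}(\tau)\preceq\vec{s}^{\,*}\prec\vec{s}(\tau+1)$ implies $f(\vec{s}^{\,*})=\vec{s}(\tau+1)$. $\mathbb{B}$ is one-stepping (monotone-stepping) if all its trajectories are. Conversion. For $N\ge n$ and $s\in\{0,1\}^n$ let $W^s\subset\mathbb{R}^N$ be the set of all $\vec{x}$ such that for every $i\in[n]$: $x_i<-1$ if $s_i=0$, and $x_i>1$ if $s_i=1$. A continuous conversion of $f:\{0,1\}^n\to\{0,1\}^n$ is a continuous function $Q=(Q_1,\dots,Q_n)$ from $\mathbb{R}^n$ to $[0,1]^n$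 such that $Q_i(\vec{x})=f_i(s)$ for all $s\in\{0,1\}^n$, all $\vec{x}\in W^s$ (here with $N=n$) and all $i\in[n]$, where $f=(f_1,\dots,f_n)$. A conversion scheme $\mathcal{Q}$ is a map that assigns to each Boolean function $f$ a continuous conversion $Q(f)$. The flow $\mathbb{D}_2(f,\vec{\gamma},\mathcal{Q})$. Let $g(x)=3x-x^3-3$ and let $L(x)=0$ for $x\le -1$, $L(x)=(x+1)/2$ for $-1<x<1$, $L(x)=1$ for $x\ge 1$. For a $2n$-dimensional vector $\vec{\gamma}$ of positive reals and $Q=Q(f)$, $\mathbb{D}_2(f,\vec{\gamma},\mathcal{Q})$ is the flow of the ODE system, for $i\in[n]$, $$\dot{x}_i=\gamma_i\,(g(x_i)+6L(x_{i+n})),\qquad \dot{x}_{i+n}=\gamma_{i+n}\,(g(x_{i+n})+6Q_i(x_1,\dots,x_n)),$$ with state space $M=[x^-,x^+]^{2n}$ (which is forward-invariant), where $x^-\approx-2.1038$ is the unique real root of $3x-x^3-3$ and $x^+=-x^-$ is the unique real root of $3x-x^3+3$. Its discretization is $S=(S_1,\dots,S_n):M\to\{0,1\}^n$ with $S_i(\vec{x})=0$ if $x_i\le 0$ and $S_i(\vec{x})=1$ if $x_i>0$. In the claim $W^s$ is taken with $N=2n$ (so only the coordinates $x_1,\dots,x_n$ are restricted), and the sets $U^s$ are subsets of $M$, open in $M$. Consistency. Let $\mathbb{D}$ be a flow on a forward-invariant set $M$ with a discretization $S=(S_1,\dots,S_n):M\to\{0,1\}^n$. Let $B=\bigcup_{i\in[n]}\mathrm{bd}(S_i^{-1}\{0\})$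 (boundaries in $M$). The trajectory $\vec{x}(t)$, $t\ge 0$, of $\vec{x}=\vec{x}(0)$ has the transversality property if there is an increasing sequence $\{t_k\}_{0\le k<K}$ of nonnegative reals, $0<K\le\infty$ (put $t_K=\infty$ if $K<\infty$), such that: (a) $t_0=0$; (b) $\vec{x}(t)\notin B$ for all $t\in[t_0,t_1)$ (so $S(\vec{x}(t))$ is constant there); (c) for all $k<K$ and all $t\in(t_k,t_{k+1})$, $\vec{x}(t)\notin B$ (so $S(\vec{x}(t))$ is constant there); (d) for all $0<k<K$, $\lim_{t\to t_k^-}S(\vec{x}(t))\ne\lim_{t\to t_k^+}S(\vec{x}(t))$; (e) if $K=\infty$ then $\lim_{k\to\infty}t_k=\infty$. Such a sequence is unique, and one associates with $\vec{x}$ the Boolean sequence $$\vec{s}^{\,\vec{x}}(\tau)=S\big(\vec{x}(\tfrac{t_\tau+t_{\tau+1}}{2})\big)\ \text{ if }\tau+1<K,\qquad \vec{s}^{\,\vec{x}}(\tau)=S(\vec{x}(t_{K-1}+\tau+1))\ \text{ if }\tau+1\ge K.$$ The trajectory of $\vec{x}$ is strongly consistent with $\mathbb{B}$ if it has the transversality property and $\vec{s}^{\,\vec{x}}(\tau+1)=f(\vec{s}^{\,\vec{x}}(\tau))$ for all $\tau\ge 0$. It is consistent with $\mathbb{B}$ if it has the transversality property and for all $\tau\ge 0$: for every $i$, $s_i^{\vec{x}}(\tau+1)=f_i(\vec{s}^{\,\vec{x}}(\tau))$ or $s_i^{\vec{x}}(\tau+1)=s_i^{\vec{x}}(\tau)$;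 and $\vec{s}^{\,\vec{x}}(\tau+1)=\vec{s}^{\,\vec{x}}(\tau)$ if and only if $\vec{s}^{\,\vec{x}}(\tau)$ is a fixed point of $\mathbb{B}$. The flow is (strongly) consistent with $\mathbb{B}$ on $U\subseteq M$ if every trajectory starting in $U$ is (strongly) consistent with $\mathbb{B}$. The flow is (strongly) consistent with $\mathbb{B}$ (no set mentioned) if it is (strongly) consistent with $\mathbb{B}$ on some open $U\subseteq M$ that is universal, i.e. $S$ maps $U$ onto $\{0,1\}^n$. *)

(* Defs.v *)
(* Libraries: MathComp and MathComp-Analysis. *)
From HB Require Import structures.
From mathcomp Require Import all_boot all_order all_algebra.
From mathcomp Require Import all_classical all_reals all_analysis.
From mathcomp Require Import ring lra.
Set Implicit Arguments.
Unset Strict Implicit.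
Unset Printing Implicit Defensive.
Import Order.TTheory GRing.Theory Num.Theory.
Import numFieldNormedType.Exports.
Local Open Scope classical_set_scope.
Local Open Scope ring_scope.

Section BooleanSystems.
Variable n : nat.

Definition state := {ffun 'I_n -> bool}.

Definition hamming (s s' : state) : nat := #|[pred i | s i != s' i]|.

Definition one_stepping_trajectory (f : state -> state) (s : state) : Prop :=
  forall tau : nat, (hamming (iter tau f s) (iter tau.+1 f s) <= 1)%N.

Definition one_stepping (f : state -> state) : Prop :=
  forall s, one_stepping_trajectory f s.

Definition between (s s' s1 : state) : Prop :=
  (forall i, s i = s1 i -> s i = s' i) /\ s' <> s1.

Definition monotone_stepping_trajectory (f : state -> state) (s : state) :
    Prop :=
  forall (tau : nat) (s' : state),
    between (iter tau f s) s' (iter tau.+1 f s) -> f s' = iter tau.+1 f s.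

Definition monotone_stepping (f : state -> state) : Prop :=
  forall s, monotone_stepping_trajectory f s.

End BooleanSystems.

Section Conversion.
Variable R : realType.

Definition W (n : nat) (s : state n) : set 'rV[R]_n :=
  [set x | forall i, if s i then 1 < x 0 i else x 0 i < -1].

(* The version of [W s] in R^(2n): only the first n coordinates matter. *)
Definition W2 (n : nat) (s : state n) : set 'rV[R]_(n + n) :=
  [set x | W s (lsubmx x)].

Definition continuous_conversion (n : nat) (f : state n -> state n)
    (Q : 'rV[R]_n -> 'rV[R]_n) : Prop :=
  [/\ continuous Q,
      forall x i, 0 <= Q x 0 i <= 1 &
      forall s x, W s x -> forall i, Q x 0 i = (f s i)%:R].

Record conversion_scheme := ConversionScheme {
  conversion :> forall n, (state n -> state n) -> 'rV[R]_n -> 'rV[R]_n ;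
  conversionP : forall n (f : state n -> state n),
    continuous_conversion f (@conversion n f)
}.

End Conversion.

(* A flow on [M] is given by the set [D] of its trajectories, which are
   functions of which only the values at nonnegative times are relevant. *)
Section Consistency.
Variables (R : realType) (E : topologicalType) (n : nat).
Implicit Types (M U : set E) (S : E -> state n) (x : R -> E).
Implicit Types (D : set (R -> E)) (t : nat -> R).

Definition open_in M U : Prop := exists2 V : set E, open V & U = M `&` V.

Definition boundary_in M (A : set E) : set E :=
  M `&` closure A `&` closure (M `\` A).

Definition switching_set M S : set E :=
  \bigcup_(i in [set: 'I_n])
    boundary_in M [set y | M y /\ S y i = false].

(* The length K of a switching sequence: [Some m] is m, [None] is infinity. *)
Definition below (K : option nat) (k : nat) : bool :=
  if K is Some m then (k < m)%N else true.

Definition switch_time (K : option nat) t (k : nat) : \bar R :=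
  if below K k then (t k)%:E else +oo%E.

(* States form a finite discrete space, so that having a limit there means
   being eventually equal to it. *)
Definition transversal M S x (K : option nat) t : Prop :=
  let B := switching_set M S in
  (below K 0 /\ forall k, below K k.+1 -> t k < t k.+1) /\
  [/\ t 0%N = 0,
      forall u, 0 <= u -> (u%:E < switch_time K t 1)%E -> ~ B (x u),
      forall k u, below K k -> t k < u -> (u%:E < switch_time K t k.+1)%E ->
        ~ B (x u),
      forall k, (0 < k)%N -> below K k -> exists a b : state n,
        [/\ \forall u \near (t k)^'-, S (x u) = a,
            \forall u \near (t k)^'+, S (x u) = b & a <> b] &
      K = None -> t @ \oo --> +oo].

Definition boolean_sequence S x (K : option nat) t (tau : nat) : state n :=
  if K is Some m then
    if (tau.+1 < m)%N then S (x ((t tau + t tau.+1) / 2))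
    else S (x (t m.-1 + tau.+1%:R))
  else S (x ((t tau + t tau.+1) / 2)).

Definition strongly_consistent_trajectory M S (f : state n -> state n) x :
    Prop :=
  exists K t, transversal M S x K t /\
    let sx := boolean_sequence S x K t in
    forall tau, sx tau.+1 = f (sx tau).

Definition consistent_trajectory M S (f : state n -> state n) x : Prop :=
  exists K t, transversal M S x K t /\
    let sx := boolean_sequence S x K t in
    forall tau,
      (forall i, sx tau.+1 i = f (sx tau) i \/ sx tau.+1 i = sx tau i) /\
      (sx tau.+1 = sx tau <-> f (sx tau) = sx tau).

Definition strongly_consistent_on M S f D U : Prop :=
  forall x, D x -> U (x 0) -> strongly_consistent_trajectory M S f x.

Definition consistent_on M S f D U : Prop :=
  forall x, D x -> U (x 0) -> consistent_trajectory M S f x.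

Definition universal S U : Prop := S @` U = [set: state n].

Definition strongly_consistent M S f D : Prop :=
  exists U, [/\ open_in M U, universal S U & strongly_consistent_on M S f D U].

Definition consistent M S f D : Prop :=
  exists U, [/\ open_in M U, universal S U & consistent_on M S f D U].

End Consistency.

Section FlowD2.
Variable R : realType.

Definition g (x : R) : R := 3 * x - x ^+ 3 - 3.

Definition L (x : R) : R :=
  if x <= -1 then 0 else if x < 1 then (x + 1) / 2 else 1.

Definition xminus : R := get [set x : R | g x = 0].

Definition xplus : R := - xminus.

Lemma g_eq0 (x : R) : g x = 0 <-> x = xminus.
Proof.
have root_lt y : g y = 0 -> y < -2.
  rewrite /g => gy; rewrite ltNge; apply/negP => yge.
  have : 0 <= (y - 1) ^+ 2 * (y + 2) by rewrite mulr_ge0 ?sqr_ge0//; lra.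
  have -> : (y - 1) ^+ 2 * (y + 2) = y ^+ 3 - 3 * y + 2 by ring.
  lra.
have uniq y z : g y = 0 -> g z = 0 -> y = z.
  move=> gy gz; have [yl zl] := (root_lt _ gy, root_lt _ gz).
  have e : (y - z) * (y * y + y * z + z * z - 3) = g z - g y.
    by rewrite /g; ring.
  move: e; rewrite gy gz subrr => /eqP; rewrite mulf_eq0 => /orP[|/eqP q0].
    by rewrite subr_eq0 => /eqP.
  have : 0 <= (- 2 - y) * (- 2 - z) by rewrite mulr_ge0//; lra.
  have : 0 <= (- 2 - y) * (- 2 - y) by rewrite mulr_ge0//; lra.
  have : 0 <= (- 2 - z) * (- 2 - z) by rewrite mulr_ge0//; lra.
  by nra.
have [y gy] : exists y, g y = 0.
  pose p : {poly R} := 'X^3 - 3%:P * 'X + 3%:P.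
  have pE y : p.[y] = - g y.
    rewrite /p /g hornerD hornerC hornerD hornerXn hornerN hornerM hornerC
      hornerX.
    by ring.
  have [||y _ /rootP] := @poly_ivt R p (- 3) (- 2); first by lra.
    by rewrite !pE /g; apply/andP; split; lra.
  by rewrite pE => /eqP; rewrite oppr_eq0 => /eqP gy; exists y.
have gm : g xminus = 0 by exact: (@getI _ [set x | g x = 0] y gy).
by split=> [gx|->//]; exact: uniq.
Qed.

Variable n : nat.

Definition M2 : set 'rV[R]_(n + n) :=
  [set x | forall j, xminus <= x 0 j <= xplus].

(* Meaningful on [M2] only. *)
Definition S2 (x : 'rV[R]_(n + n)) : state n :=
  [ffun i => 0 < x 0 (lshift n i)].

(* [Q] is only continuous, so a starting point may have several trajectories;
   all of them are included. The one-sided equations at time 0 follow from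
   continuity at 0. *)
Definition D2 (gamma : 'rV[R]_(n + n)) (Q : 'rV[R]_n -> 'rV[R]_n) :
    set (R -> 'rV[R]_(n + n)) :=
  [set x : R -> 'rV[R]_(n + n) | [/\ M2 (x 0),
      {within `[0, +oo[, continuous x} &
    forall (t : R) (i : 'I_n), 0 < t ->
      is_derive t 1 (fun u : R => x u 0 (lshift n i))
        (gamma 0 (lshift n i) *
          (g (x t 0 (lshift n i)) + 6 * L (x t 0 (rshift n i)))) /\
      is_derive t 1 (fun u : R => x u 0 (rshift n i))
        (gamma 0 (rshift n i) *
          (g (x t 0 (rshift n i)) + 6 * Q (lsubmx (x t)) 0 i))]].

End FlowD2.

Arguments M2 {R n}.
Arguments S2 {R n}.

(* Main.v *)
(* By the substitution g(x) + 6 L(y) = h(x) + 3 clip(y) with h(x) = 3 x - x^3 and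
   clip the truncation to [-1, 1], every coordinate obeys an odd law
   x' = gamma (h(x) + 3 clip(y)), y' = delta (h(y) + 3 w), where w = 2 Q - 1, and
   flipping signs lets one assume that the current Boolean target is 1 everywhere.
   While all x_i lie near the wells |x_i| >= 1, w is close to the target: each y_i
   drifts towards it, and x_i can leave its well only once y_i has passed the fold
   value 2/3; then x_i crosses to the other well in a time independent of delta.
   Only during these crossings are the signals w unreliable, and the loss of the
   y_i is paid for by a Lyapunov term: a smooth step function of the crossing
   coordinates, which grows along each crossing and is bounded in total. Hence for
   small delta no y_i falls back below the fold, all the coordinates that should
   switch do so exactly once, and at the end of the stage the configuration is again
   of the initial form, for the next Boolean state. Monotone stepping says that the
   target stays the same until the last of the crossings. *)
Require Import Defs.
From HB Require Import structures.
From mathcomp Require Import all_boot all_order all_algebra.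
From mathcomp Require Import all_classical all_reals all_analysis.
From mathcomp Require Import ring lra.
Set Implicit Arguments.
Unset Strict Implicit.
Unset Printing Implicit Defensive.
Import Order.TTheory GRing.Theory Num.Theory.
Import numFieldNormedType.Exports.
Local Open Scope classical_set_scope.
Local Open Scope ring_scope.

(** * Last crossing times, real induction and barrier arguments on the line *)

Section RealLine.
Variable R : realType.
Implicit Types (F V : R -> R) (a b c d e s t u : R).

Lemma continuous_gt F c s : continuous F -> c < F s ->
  exists2 e, 0 < e & forall t, `|t - s| < e -> c < F t.
Proof.
move=> Fc cs; have /nbhs_ballP[e /= e0 He] : \forall t \near s, c < F t.
  exact: cvgr_gt (Fc s) _ cs.
by exists e => // t ts; apply: He; rewrite /ball /= distrC.
Qed.

Lemma continuous_lt F c s : continuous F -> F s < c ->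
  exists2 e, 0 < e & forall t, `|t - s| < e -> F t < c.
Proof.
move=> Fc cs; have /nbhs_ballP[e /= e0 He] : \forall t \near s, F t < c.
  exact: cvgr_lt (Fc s) _ cs.
by exists e => // t ts; apply: He; rewrite /ball /= distrC.
Qed.

(** The time is the supremum of the points between [a] and [b] where [F <= c]. A value below [c]
    there would persist a little longer, against maximality. *)
Lemma last_time_le F a b c : continuous F -> a <= b -> F a <= c -> c < F b ->
  exists t, [/\ a <= t, t < b, F t = c & forall u, t < u -> u <= b -> c < F u].
Proof.
move=> Fc ab Fa Fb; pose A := [set t | a <= t <= b /\ F t <= c].
have Aa : A a by split=> //; rewrite lexx.
have supA : has_sup A by split; [exists a | exists b => t [/andP[]]].
have ubA t : A t -> t <= sup A by move=> At; apply: (ub_le_sup supA.2).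
have as_ : a <= sup A by exact: ubA.
have sb : sup A <= b by apply: ge_sup => [|t [/andP[]]//]; exists a.
have Fs : F (sup A) <= c.
  rewrite leNgt; apply/negP => /(continuous_gt Fc)[e e0 He].
  have [t At te] := sup_adherent e0 supA.
  have := ubA _ At; case: At => _ Ft ts.
  by have : c < F t; [apply: He; rewrite ltr_norml; lra|lra].
have Fgt u : sup A < u -> u <= b -> c < F u.
  move=> su ub; rewrite ltNge; apply/negP => Fu.
  have /ubA : A u by split=> //; rewrite ub; lra.
  by lra.
have sltb : sup A < b.
  by rewrite lt_neqAle sb andbT; apply: contraTneq Fs => ->; rewrite -ltNge.
exists (sup A); split=> //; apply/eqP; rewrite eq_le Fs /= leNgt.
apply/negP => /(continuous_lt Fc)[e e0 He].
pose m := Num.min b (sup A + e / 2).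
have sm : sup A < m by rewrite lt_min; apply/andP; split; lra.
have mb : m <= b by rewrite ge_min lexx.
have := Fgt _ sm mb; rewrite ltNge => /negP; apply; apply/ltW/He.
have : m <= sup A + e / 2 by rewrite ge_min lexx orbT.
by rewrite ltr_norml; lra.
Qed.

Lemma last_time_ge F a b c : continuous F -> a <= b -> c <= F a -> F b < c ->
  exists t, [/\ a <= t, t < b, F t = c & forall u, t < u -> u <= b -> F u < c].
Proof.
move=> Fc ab Fa Fb.
have [||||t [h1 h2 h3 h4]] := @last_time_le (fun t => - F t) a b (- c) => //.
- by move=> t; apply: cvgN; apply: Fc.
- by rewrite lerN2.
- by rewrite ltrN2.
exists t; split=> // [|u tu ub]; first by move: h3 => /oppr_inj.
by rewrite -ltrN2; apply: h4.
Qed.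

(** At the infimum of the counterexamples the step applies, all earlier points being good, and it
    pushes the counterexamples a positive distance away from their own infimum. *)
Lemma real_induction (P : R -> Prop) a b :
  (forall t, a <= t <= b -> (forall u, a <= u < t -> P u) ->
     exists2 e, 0 < e & forall u, t <= u < t + e -> P u) ->
  forall t, a <= t <= b -> P t.
Proof.
move=> step t /andP[at_ tb]; apply: contrapT => nPt.
pose A := [set u | a <= u /\ ~ P u].
have infA : has_inf A by split; [exists t | exists a => u []].
have lbA u : A u -> inf A <= u by move=> Au; apply: (ge_inf infA.2).
have aA : a <= inf A by apply: lb_le_inf; [exists t|move=> u []].
have At : inf A <= t by apply: lbA.
have [||e e0 He] := step (inf A); first by lra.
  move=> u /andP[au uA]; apply: contrapT => nPu.
  by have := lbA u (conj au nPu); lra.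
have [u Au ue] := inf_adherent e0 infA.
by apply: Au.2; apply: He; rewrite lbA.
Qed.

Lemma nondecreasing_derive F a b : continuous F -> a <= b ->
  (forall t, a < t < b -> exists2 d, is_derive t 1 F d & 0 <= d) -> F a <= F b.
Proof.
move=> Fc; rewrite le_eqVlt => /predU1P[-> //|ab dF].
have dF' t : t \in `]a, b[ -> is_derive t 1 F ('D_1 F t).
  rewrite in_itv /= => /dF[d Fd _]; rewrite derive_val; exact: Fd.
have [|t tab e] := MVT ab dF'; first exact: continuous_subspaceT.
move: (tab); rewrite in_itv /= => /dF[d Fd d0].
by rewrite -subr_ge0 e derive_val mulr_ge0// subr_ge0 ltW.
Qed.

Lemma increasing_derive F a b : continuous F -> a < b ->
  (forall t, a < t < b -> exists2 d, is_derive t 1 F d & 0 < d) -> F a < F b.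
Proof.
move=> Fc ab dF.
have dF' t : t \in `]a, b[ -> is_derive t 1 F ('D_1 F t).
  rewrite in_itv /= => /dF[d Fd _]; rewrite derive_val; exact: Fd.
have [|t tab e] := MVT ab dF'; first exact: continuous_subspaceT.
move: (tab); rewrite in_itv /= => /dF[d Fd d0].
by rewrite -subr_gt0 e derive_val mulr_gt0// subr_gt0.
Qed.

Lemma derive_ge0_right F t d e : is_derive t 1 F d -> 0 < e ->
  (forall u, t < u < t + e -> F t <= F u) -> 0 <= d.
Proof.
move=> Fd e0 Fge.
have cvF : h^-1 *: (F (h *: (1 : R) + t) - F t) @[h --> 0^'] --> d.
  rewrite -(@derive_val _ _ _ _ _ _ _ Fd); exact: (@ex_derive _ _ _ _ _ _ _ Fd).
have cvFr := cvg_dnbhs_at_right cvF.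
rewrite -(cvg_lim _ cvFr)//; apply: limr_ge; first by apply/cvg_ex; exists d.
near=> h.
have h0 : 0 < h by [].
have he : h < e by near: h; exact: nbhs_right_lt.
apply: mulr_ge0; first by rewrite invr_ge0 ltW.
by rewrite subr_ge0; apply: Fge; rewrite /GRing.scale /= mulr1; lra.
Unshelve. all: by end_near. Qed.

(** After its last visit to level [c], [F] stays for a short while in the thin band below [c], where
    it cannot decrease. So only the sign of the derivative close to the level matters. *)
Lemma barrier F a b c e : continuous F -> 0 < e -> a <= b -> c <= F a ->
  (forall t, a < t < b -> c - e < F t < c ->
     exists2 d, is_derive t 1 F d & 0 <= d) ->
  c <= F b.
Proof.
move=> Fc e0 ab Fa dF; rewrite leNgt; apply/negP => Fb.
have [t [at_ tb Ft Fu]] := last_time_ge Fc ab Fa Fb.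
have [|e1 e10 He1] := @continuous_gt F (c - e) t Fc; first by lra.
pose m := Num.min b (t + e1 / 2).
have tm : t < m by rewrite lt_min; apply/andP; split; lra.
have mb : m <= b by rewrite ge_min lexx.
have me : m <= t + e1 / 2 by rewrite ge_min lexx orbT.
have : F t <= F m.
  apply: nondecreasing_derive => // [|u /andP[tu um]]; first exact: ltW.
  apply: dF; first by lra.
  by rewrite He1 ?Fu//; [lra|rewrite ltr_norml; lra].
by have := Fu _ tm mb; lra.
Qed.

Lemma barrier_lt F a b c e : continuous F -> 0 < e -> a < b -> c <= F a ->
  (forall t, a < t < b -> c - e < F t < c + e ->
     exists2 d, is_derive t 1 F d & 0 < d) ->
  c < F b.
Proof.
move=> Fc e0 ab Fa dF.
have Fge t : a <= t <= b -> c <= F t.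
  move=> /andP[at_ tb]; apply: (barrier Fc e0 at_ Fa) => u ut Fu.
  by have [||d ? /ltW] := dF u; [lra|lra|exists d].
rewrite lt_neqAle Fge ?lexx ?ltW// andbT; apply/eqP => Fb.
have [|e1 e10 He1] := @continuous_lt F (c + e) b Fc; first by lra.
pose m := Num.max a (b - e1 / 2).
have am : a <= m by rewrite le_max lexx.
have mb : m < b by rewrite gt_max; apply/andP; split; lra.
have me : b - e1 / 2 <= m by rewrite le_max lexx orbT.
have : F m < F b.
  apply: increasing_derive => // u /andP[mu ub]; apply: dF; first by lra.
  have : F u < c + e by apply: He1; rewrite ltr_norml; lra.
  have : c <= F u by apply: Fge; lra.
  lra.
have : c <= F m by apply: Fge; lra.
lra.
Qed.

(** The Lyapunov estimate: from the last time at level [c] on, [F + V] does not decrease, so [F]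
    loses no more than the range [v] of [V]. *)
Lemma retreat_bound F V a b c v : continuous F -> continuous V ->
  (forall t, 0 <= V t <= v) -> a <= b -> c <= F a ->
  (forall t, a < t < b -> F t < c ->
     exists2 d, is_derive t 1 (fun u => F u + V u) d & 0 <= d) ->
  c - v <= F b.
Proof.
move=> Fc Vc Vv ab Fa dF; have [Fb|Fb] := leP c (F b).
  by have := Vv b; lra.
have [t [at_ tb Ft Fu]] := last_time_ge Fc ab Fa Fb.
have : F t + V t <= F b + V b.
  apply: (@nondecreasing_derive (fun u => F u + V u)); last first.
  - by move=> u ub; apply: dF; [lra|apply: Fu; lra].
  - exact: ltW.
  - by move=> u; apply: cvgD; [apply: Fc|apply: Vc].
by have := Vv b; have := Vv t; lra.
Qed.

End RealLine.

(** * The cubic nonlinearity, the truncation and a smooth step *)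

Section Cubic.
Variable R : realType.
Implicit Types x y c d a k eta : R.

Definition cubic x : R := 3 * x - x ^+ 3.

Definition clip x : R := if x <= -1 then -1 else if x < 1 then x else 1.

Lemma clip_ge c y : c <= 1 -> c <= y -> c <= clip y.
Proof. by rewrite /clip; case: (leP y (-1)); case: (ltP y 1); lra. Qed.

Lemma clip_le y : -1 < clip y -> clip y <= y.
Proof. by rewrite /clip; case: (leP y (-1)); case: (ltP y 1); lra. Qed.

Lemma clip_bounds y : -1 <= clip y <= 1.
Proof. by rewrite /clip; case: (leP y (-1)); case: (ltP y 1); lra. Qed.

Lemma clipN y : clip (- y) = - clip y.
Proof.
rewrite /clip; case: (leP y (-1)); case: (ltP y 1); case: (leP (- y) (-1));
  by case: (ltP (- y) 1); lra.
Qed.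

Lemma cubicN x : cubic (- x) = - cubic x.
Proof. by rewrite /cubic; ring. Qed.

Lemma cubic_ge x : x <= 2 -> -2 <= cubic x.
Proof.
move=> x2; have : 0 <= (x + 1) ^+ 2 * (2 - x).
  by rewrite mulr_ge0 ?sqr_ge0//; lra.
rewrite /cubic; have -> : (x + 1) ^+ 2 * (2 - x) = 3 * x - x ^+ 3 + 2 by ring.
by lra.
Qed.

Lemma cubic_bounds x : -3 <= x <= 3 -> -18 <= cubic x <= 18.
Proof.
move=> x3; rewrite /cubic.
have e1 : 3 * x - x ^+ 3 + 18 = (3 - x) * ((x + 3 / 2) ^+ 2 + 15 / 4) by field.
have e2 : 18 - (3 * x - x ^+ 3) = (3 + x) * ((x - 3 / 2) ^+ 2 + 15 / 4) by field.
have : 0 <= (3 - x) * ((x + 3 / 2) ^+ 2 + 15 / 4).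
  by rewrite mulr_ge0//; [lra|rewrite addr_ge0 ?sqr_ge0//; lra].
have : 0 <= (3 + x) * ((x - 3 / 2) ^+ 2 + 15 / 4).
  by rewrite mulr_ge0//; [lra|rewrite addr_ge0 ?sqr_ge0//; lra].
by rewrite -e1 -e2; lra.
Qed.

(* The fast equation has its fold at [x = -1], [y = 2 / 3]: beyond it, [x] keeps
   a positive speed even if [y] falls back by [eta ^+ 2 / 96]. *)
Lemma escape_rate eta x y : 0 < eta <= 1 / 2 -> -1 + eta / 2 <= x <= 7 / 4 ->
  2 / 3 - eta ^+ 2 / 96 < y -> eta ^+ 2 / 32 <= cubic x + 3 * clip y.
Proof.
move=> eta01 xI yI; have e2 : 0 <= eta ^+ 2 by exact: sqr_ge0.
have cy : 2 / 3 - eta ^+ 2 / 96 <= clip y by apply: clip_ge; lra.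
have : (eta / 2) ^+ 2 * (1 / 4) <= (x + 1) ^+ 2 * (2 - x).
  apply: ler_pM; [exact: sqr_ge0|lra| |lra].
  by rewrite lerXn2r ?nnegrE//; lra.
rewrite /cubic; have -> : (x + 1) ^+ 2 * (2 - x) = 3 * x - x ^+ 3 + 2 by ring.
have -> : (eta / 2) ^+ 2 * (1 / 4) = eta ^+ 2 / 16 by field.
lra.
Qed.

(** Serves [posq], where the kink of [Num.max] defeats the usual differentiation rules while the
    quadratic error is easily checked by cases. *)
Lemma is_derive_quadratic_error (F : R -> R) x d :
  (forall k, `|F (k + x) - F x - d * k| <= k ^+ 2) -> is_derive x 1 F d.
Proof.
move=> Fd; suff cvF : h^-1 *: (F (h *: (1 : R) + x) - F x) @[h --> 0^'] --> d.
  apply: DeriveDef; first by apply/cvg_ex; exists d.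
  exact: cvg_lim cvF.
apply/cvgrPdist_le => e e0; near=> h.
have h0 : h != 0 by near: h; exact: nbhs_dnbhs_neq.
have he : `|h| <= e by near: h; apply: dnbhs0_le.
rewrite /GRing.scale /= mulr1 distrC.
have -> : h^-1 * (F (h + x) - F x) - d = h^-1 * (F (h + x) - F x - d * h).
  by field.
rewrite normrM normfV ler_pdivrMl ?normr_gt0// (le_trans (Fd h))//.
by rewrite -[h ^+ 2]ger0_norm ?sqr_ge0// normrX expr2 ler_wpM2l.
Unshelve. all: by end_near. Qed.

Definition posq x : R := Num.max 0 x ^+ 2.

Lemma posq_ge0 x : 0 <= posq x. Proof. exact: sqr_ge0. Qed.

Lemma is_derive_posq x : is_derive x 1 posq (2 * Num.max 0 x).
Proof.
apply: is_derive_quadratic_error => k; rewrite /posq ler_norml.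
case: (leP 0 (k + x)); case: (leP 0 x) => x0 kx0; apply/andP; split; nra.
Qed.

(* Continuously differentiable, constant below [a] and above [a + 5 / 2]. *)
Definition step a x : R := (25 / 4) ^+ 2 - posq (25 / 4 - posq (x - a)).

Definition dstep a x : R :=
  4 * (Num.max 0 (25 / 4 - posq (x - a)) * Num.max 0 (x - a)).

Lemma is_derive_step a x : is_derive x 1 (step a) (dstep a x).
Proof.
have d1 : is_derive x 1 (fun x => x - a) 1.
  by apply: is_derive_eq; rewrite subr0.
have d2 : is_derive x 1 (fun x => 25 / 4 - posq (x - a))
    (- (2 * Num.max 0 (x - a) * 1)).
  have := @is_derive1_comp _ posq (fun x => x - a) x _ _ (is_derive_posq _) d1.
  by move=> d; apply: is_derive_eq; ring.
have := @is_derive1_comp _ posq (fun x => 25 / 4 - posq (x - a)) x _ _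
  (is_derive_posq _) d2.
by move=> d; apply: is_derive_eq; rewrite /dstep; ring.
Qed.

Lemma step_bounds a x : 0 <= step a x <= 40.
Proof.
rewrite /step; have := posq_ge0 (25 / 4 - posq (x - a)).
have := posq_ge0 (x - a); set p := posq (x - a) => p0.
have : posq (25 / 4 - p) <= (25 / 4) ^+ 2.
  rewrite /posq lerXn2r ?nnegrE ?le_max ?lexx// ge_max; apply/andP; split; lra.
lra.
Qed.

Lemma dstep_ge0 a x : 0 <= dstep a x.
Proof. by rewrite /dstep !mulr_ge0// le_max lexx. Qed.

Lemma dstep_eq0 a x : a <= -3 / 4 -> x <= a \/ 7 / 4 <= x -> dstep a x = 0.
Proof.
move=> a1 [xa|xa]; rewrite /dstep.
  by rewrite (max_l (_ : x - a <= 0)) ?mulr0//; lra.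
rewrite max_l ?mul0r ?mulr0// /posq max_r; last lra.
suff : (5 / 2) ^+ 2 <= (x - a) ^+ 2 by lra.
by rewrite lerXn2r ?nnegrE//; lra.
Qed.

Lemma dstep_ge eta x : 0 < eta <= 1 / 2 -> -1 + eta <= x <= 1 ->
  eta <= dstep (-1 + eta / 2) x.
Proof.
move=> eta0 xI; rewrite /dstep /posq.
have e : Num.max 0 (x - (-1 + eta / 2)) = x - (-1 + eta / 2) by rewrite max_r//; lra.
rewrite e; set z := x - _; have zI : eta / 2 <= z <= 2 by rewrite /z; lra.
have z4 : z ^+ 2 <= 4.
  by rewrite (_ : 4 = 2 ^+ 2) ?lerXn2r ?nnegrE//; [lra|lra|rewrite expr2; ring].
rewrite max_r; last lra.
have : 2 * (eta / 2) <= (25 / 4 - z ^+ 2) * z by rewrite ler_pM//; lra.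
lra.
Qed.

End Cubic.

(** * One stage of the dynamics *)

Section Stage.
Variables (R : realType) (n : nat).

(* [704 = 22 * 32]: [21] bounds the speed [cubic y + 3 * w] on the box, and
   [gm * eta ^+ 3 / 32] bounds from below the growth rate of [step] along a crossing. *)
Definition stage_weight (eta gm : R) : R := 704 / (gm * eta ^+ 3).

Definition stage_loss (eta gm : R) : R := stage_weight eta gm * (40 * n%:R).

(** A slow rate [delta] below this loses at most [delta * stage_loss], less than [eta ^+ 2 / 400],
    which is within the margin that [escape_rate] allows below the fold. The summand 1 later forces
    a stage with a crossing to last at least [2 * (stage_loss + 1)]. *)
Definition stage_mu (eta gm : R) : R :=
  eta ^+ 2 / (400 * (stage_loss eta gm + 1)).

Lemma stage_weight_gt0 eta gm : 0 < eta -> 0 < gm -> 0 < stage_weight eta gm.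
Proof.
move=> eta0 gm0; apply: divr_gt0; first by rewrite ltr0n.
by apply: mulr_gt0 => //; exact: exprn_gt0.
Qed.

Lemma stage_loss_ge0 eta gm : 0 < eta -> 0 < gm -> 0 <= stage_loss eta gm.
Proof.
move=> eta0 gm0; apply: mulr_ge0; last by rewrite mulr_ge0.
by rewrite ltW// stage_weight_gt0.
Qed.

Lemma stage_mu_gt0 eta gm : 0 < eta -> 0 < gm -> 0 < stage_mu eta gm.
Proof.
move=> eta0 gm0; apply: divr_gt0; first exact: exprn_gt0.
by apply: mulr_gt0; [rewrite ltr0n|rewrite ltr_wpDl// stage_loss_ge0].
Qed.

Variables (C : pred 'I_n) (u y w : 'I_n -> R -> R) (gamma delta : 'I_n -> R).
Variables (eta gm T : R).
Hypotheses (eta_bounds : 0 < eta <= 1 / 2) (gm_gt0 : 0 < gm).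
Hypotheses (gamma_ge : forall i, gm <= gamma i).
Hypotheses (delta_gt0 : forall i, 0 < delta i).
Hypotheses (delta_lt : forall i, delta i < stage_mu eta gm).
Hypotheses (u_cont : forall i, continuous (u i)).
Hypotheses (y_cont : forall i, continuous (y i)).
Hypotheses (u_ode : forall i (t : R), 0 < t ->
  is_derive t 1 (u i) (gamma i * (cubic (u i t) + 3 * clip (y i t)))).
Hypotheses (y_ode : forall i (t : R), 0 < t ->
  is_derive t 1 (y i) (delta i * (cubic (y i t) + 3 * w i t))).
Hypotheses (u_box : forall i (t : R), 0 <= t -> -3 <= u i t <= 3).
Hypotheses (y_box : forall i (t : R), 0 <= t -> -3 <= y i t <= 3).
Hypotheses (w_box : forall i (t : R), -1 <= w i t <= 1).
Hypotheses (T_ge0 : 0 <= T).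
Hypotheses (init_moving : forall j, C j -> u j T <= -1 /\ y j T <= -1 / 2).
Hypotheses (init_resting : forall i, ~~ C i -> 1 <= u i T /\ 1 / 2 <= y i T).

(** The second alternative lets the same estimates cover a fixed point, where nothing moves and the
    stage never ends. *)
Definition unfinished (t : R) := (exists2 j, C j & u j t < 1) \/ (forall j, ~~ C j).

(** While some moving coordinate is in the middle of its crossing, nothing beyond [w_box] is known
    of the signals. *)
Hypotheses (w_settled : forall t, T <= t -> unfinished t ->
  (forall j, C j -> u j t <= -1 + eta \/ 1 <= u j t) ->
  (forall i, ~~ C i -> 1 - eta <= u i t) -> forall i, 5 / 6 <= w i t).

Let A := stage_weight eta gm.
Let v0 := stage_loss eta gm.
Let foot := -1 + eta / 2.

Let eta_gt0 : 0 < eta.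
Proof. by case/andP: eta_bounds. Qed.

Let A_gt0 : 0 < A. Proof. exact: stage_weight_gt0. Qed.

Let v0_ge0 : 0 <= v0. Proof. exact: stage_loss_ge0. Qed.

Let delta_v0 i : 400 * (delta i * (v0 + 1)) < eta ^+ 2.
Proof.
have := delta_lt i; rewrite /stage_mu ltr_pdivlMr; first by rewrite -/v0; lra.
by apply: mulr_gt0; [rewrite ltr0n|rewrite ltr_wpDl].
Qed.

Let eta2 : 0 <= eta ^+ 2 <= 1 / 4.
Proof. by have e := eta_bounds; apply/andP; split; nra. Qed.

(* Each crossing coordinate pushes [clock] up by at most [v0 / n] in total, at a
   speed that outweighs the loss of the slow variables while the signals [w]
   are unreliable. *)
Definition clock t : R := A * \sum_(j < n) (C j)%:R * step foot (u j t).

Definition dclock t : R := A * \sum_(j < n) (C j)%:R *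
  (dstep foot (u j t) * (gamma j * (cubic (u j t) + 3 * clip (y j t)))).

Lemma clock_bounds t : 0 <= clock t <= v0.
Proof.
apply/andP; split.
  rewrite mulr_ge0 ?(ltW A_gt0)// sumr_ge0// => j _.
  by rewrite mulr_ge0//; case/andP: (step_bounds foot (u j t)).
rewrite /v0 /stage_loss ler_pM2l//.
have -> : 40 * n%:R = \sum_(j < n) 40 :> R by rewrite sumr_const card_ord mulr_natr.
apply: ler_sum => j _; have := step_bounds foot (u j t).
by case: (C j) => /= ?; [rewrite mul1r|rewrite mul0r]; lra.
Qed.

Lemma is_derive_clock (t : R) : 0 < t -> is_derive t 1 clock (dclock t).
Proof.
move=> t0; pose F (j : 'I_n) s := (C j)%:R * step foot (u j s).
have -> : clock = A \*: \sum_(j < n) F j.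
  by apply/funext => s; rewrite /clock /= fct_sumE.
apply: is_deriveZ; apply: is_derive_sum => j.
apply: (@is_deriveZ _ _ _ (step foot \o u j) (C j)%:R).
exact: is_derive1_comp (is_derive_step _ _) (u_ode j t0).
Qed.

Lemma continuous_step a : continuous (@step R a).
Proof.
move=> x; apply: differentiable_continuous; apply/derivable1_diffP.
exact: (@ex_derive _ _ _ _ _ _ _ (is_derive_step a x)).
Qed.

Lemma clock_cont : continuous clock.
Proof.
move=> t; apply: cvgM; first exact: cvg_cst.
apply: cvg_big => [|j _]; first exact: add_continuous.
apply: cvgM; first exact: cvg_cst.
apply: (@continuous_comp _ _ _ (u j) (step foot)); first exact: u_cont.
exact: continuous_step.
Qed.

(** The invariant of a stage: past [foot], a crossing coordinate has its slow variable close enough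
    to the fold for [escape_rate]. The bounds to be kept are strict, so that continuity carries them
    a little further. *)
Definition on_course t :=
  (forall j, C j -> foot <= u j t -> 2 / 3 - eta ^+ 2 / 96 < y j t) /\
  (forall i, ~~ C i -> 1 - eta < u i t).

Let foot_le : foot <= -3 / 4.
Proof. by have e := eta_bounds; rewrite /foot; lra. Qed.

Let gamma_gt0 i : 0 < gamma i.
Proof. exact: lt_le_trans (gamma_ge i). Qed.

(** The function [step foot] is flat outside the interval from [foot] to 7 / 4, and inside it
    [escape_rate] makes the coordinate rise. *)
Let escape_ge0 j t : on_course t -> C j ->
  0 <= dstep foot (u j t) * (gamma j * (cubic (u j t) + 3 * clip (y j t))).
Proof.
move=> [ct _] Cj; have [uf|uf] := lerP (u j t) foot.
  by rewrite dstep_eq0 ?mul0r//; left.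
have [uf'|uf'] := lerP (7 / 4) (u j t).
  by rewrite dstep_eq0 ?mul0r//; right.
rewrite mulr_ge0 ?dstep_ge0// mulr_ge0 ?(ltW (gamma_gt0 j))//.
apply: le_trans (escape_rate eta_bounds _ (ct j Cj (ltW uf))).
  by rewrite divr_ge0// sqr_ge0.
by rewrite /foot in uf *; lra.
Qed.

Lemma dclock_ge0 t : on_course t -> 0 <= dclock t.
Proof.
move=> ct; rewrite mulr_ge0 ?(ltW A_gt0)// sumr_ge0// => j _.
by case Cj: (C j); rewrite ?mul0r// mul1r escape_ge0.
Qed.

(** One coordinate in mid-crossing suffices, the other terms being nonnegative: it moves at speed at
    least [gm * (eta ^+ 2 / 32)] where the slope of the step is at least [eta], and the weight [A]
    normalizes the product to 22. *)
Lemma dclock_unsettled j t : on_course t -> C j -> -1 + eta < u j t < 1 ->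
  22 <= dclock t.
Proof.
move=> ct Cj uI; have e := eta_bounds.
have uf : foot <= u j t by rewrite /foot; lra.
have h1 : eta <= dstep foot (u j t) by apply: dstep_ge => //; lra.
have h2 : eta ^+ 2 / 32 <= cubic (u j t) + 3 * clip (y j t).
  by apply: escape_rate => //; [rewrite /foot in uf; lra|exact: ct.1].
have eta0 : 0 < eta by lra.
have h3 : eta * (gm * (eta ^+ 2 / 32)) <=
    dstep foot (u j t) * (gamma j * (cubic (u j t) + 3 * clip (y j t))).
  have g0 := ltW gm_gt0; have q0 : 0 <= eta ^+ 2 / 32 by rewrite divr_ge0// sqr_ge0.
  by rewrite ler_pM ?ler_pM ?mulr_ge0//; exact: ltW.
have -> : 22 = A * (eta * (gm * (eta ^+ 2 / 32))).
  by rewrite /A /stage_weight; field; rewrite !lt0r_neq0.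
rewrite ler_pM2l// (bigD1 j)//= Cj mul1r -[leLHS]addr0 lerD// sumr_ge0// => i _.
by case Ci: (C i); rewrite ?mul0r// mul1r escape_ge0.
Qed.

(** During a crossing the clock rate 22 outweighs the worst drift -21. Otherwise [w] is at least 5 /
    6 and the drift itself is at least [-2 + 5 / 2]; the bound -2 on the cubic is the reason for
    [y i t <= 2]. *)
Lemma drift_ge0 i t : 0 < t -> T <= t -> on_course t -> unfinished t ->
  y i t <= 2 -> 1 / 2 - dclock t <= cubic (y i t) + 3 * w i t.
Proof.
move=> t0 Tt ct ut y2.
have [[j Cj uI]|settled] := pselect (exists2 j, C j & -1 + eta < u j t < 1).
  have := dclock_unsettled ct Cj uI; have := w_box i t.
  by have := cubic_bounds (y_box i (ltW t0)); lra.
have := dclock_ge0 ct; have := cubic_ge y2.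
suff : 5 / 6 <= w i t by lra.
apply: w_settled => // [j Cj|k Ck]; last by apply/ltW/ct.2.
have [|uj] := leP (u j t) (-1 + eta); first by left.
have [|uj'] := leP 1 (u j t); first by right.
by case: settled; exists j; rewrite ?uj.
Qed.

(** Corrected by the clock, [y i] rises at rate at least [delta i / 2], and the correction costs at
    most [delta i * v0]. *)
Lemma gain i t0 t1 : T <= t0 <= t1 ->
  (forall t, T <= t < t1 -> on_course t /\ unfinished t) ->
  (forall t, t0 < t < t1 -> y i t <= 2) ->
  y i t0 + delta i * ((t1 - t0) / 2 - v0) <= y i t1.
Proof.
move=> /andP[Tt0 t01] good y2; have T0 := T_ge0.
pose F t := y i t + delta i * (clock t - t / 2).
have : F t0 <= F t1.
  apply: nondecreasing_derive => // [t|t tI].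
    apply: cvgD; first exact: y_cont.
    apply: cvgM; first exact: cvg_cst.
    apply: cvgB; first exact: clock_cont.
    by apply: cvgM; [exact: cvg_id|exact: cvg_cst].
  have tpos : 0 < t by lra.
  have dy := y_ode i tpos; have dc := is_derive_clock tpos.
  exists (delta i * (cubic (y i t) + 3 * w i t) + delta i * (dclock t - 1 / 2)).
    have d2 : is_derive t 1 (fun s : R => s / 2) (1 / 2).
      by apply: is_derive_eq; rewrite /GRing.scale /=; lra.
    have d3 := @is_deriveZ _ _ _ (clock - (fun s : R => s / 2)) (delta i) _ _ _
      (is_deriveB dc d2).
    exact: is_deriveD dy d3.
  rewrite -mulrDr mulr_ge0 ?(ltW (delta_gt0 i))//.
  have [|ct ut] := good t; first by lra.
  by have := @drift_ge0 i t tpos _ ct ut (y2 t tI) => /(_ ltac:(lra)); lra.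
rewrite /F; have d0 := delta_gt0 i.
have := clock_bounds t0; have := clock_bounds t1 => b1 b0.
have : delta i * (clock t1 - clock t0) <= delta i * v0 by rewrite ler_pM2l//; lra.
lra.
Qed.

Lemma retreat i t0 t1 c : T <= t0 <= t1 ->
  (forall t, T <= t < t1 -> on_course t /\ unfinished t) ->
  c <= 2 -> c <= y i t0 -> c - delta i * v0 <= y i t1.
Proof.
move=> /andP[Tt0 t01] good c2 yc; have d0 := delta_gt0 i; have T0 := T_ge0.
apply: (@retreat_bound _ (y i) (fun t => delta i * clock t) t0) => //.
- by move=> t; apply: cvgM; [exact: cvg_cst|exact: clock_cont].
- move=> t; have := clock_bounds t => /andP[? ?].
  by rewrite ler_pM2l// mulr_ge0// ltW.
move=> t tI yt; have tpos : 0 < t by lra.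
have dy := y_ode i tpos; have dc := is_derive_clock tpos.
exists (delta i * (cubic (y i t) + 3 * w i t) + delta i * dclock t).
  exact: is_deriveD dy (@is_deriveZ _ _ _ clock (delta i) _ _ _ dc).
rewrite -mulrDr mulr_ge0 ?(ltW d0)//.
have [|ct ut] := good t; first by lra.
by have := @drift_ge0 i t tpos _ ct ut => /(_ ltac:(lra) ltac:(lra)); lra.
Qed.

Let delta_loss i : 0 <= delta i * v0 /\ 400 * (delta i * v0) < eta ^+ 2.
Proof.
split; first by rewrite mulr_ge0 ?(ltW (delta_gt0 i)).
by have := delta_v0 i; have := delta_gt0 i; rewrite mulrDr; lra.
Qed.

(** With a nonnegative slow variable the field points upward just below 1, so 1 is a barrier. *)
Let u_upward i s t : 0 <= s <= t -> 1 <= u i s ->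
  (forall r, s <= r <= t -> 0 <= y i r) -> 1 <= u i t.
Proof.
move=> /andP[s0 st] us yr; apply: (barrier (@u_cont i) ltr01 st us) => r rI ur.
have r0 : 0 < r by lra.
eexists; first exact: (u_ode i r0).
rewrite mulr_ge0 ?(ltW (gamma_gt0 i))// addr_ge0 ?mulr_ge0//; last first.
  by apply: clip_ge => //; apply: yr; lra.
have -> : cubic (u i r) = u i r * (3 - u i r ^+ 2) by rewrite /cubic; ring.
by rewrite mulr_ge0//; [lra|rewrite subr_ge0; nra].
Qed.

(** To reach [foot] the coordinate must pass upward through a level just above -1, which requires a
    slow variable almost at the fold; from then on [retreat] bounds the loss. *)
Lemma on_course_moving j t : T <= t ->
  (forall s, T <= s < t -> on_course s /\ unfinished s) ->
  C j -> foot <= u j t -> 2 / 3 - eta ^+ 2 / 96 < y j t.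
Proof.
move=> Tt good Cj uf; have e := eta_bounds; have T0 := T_ge0.
have uT := (init_moving Cj).1.
(* Since [cubic (-1 + h)] is [-2 + 3 * h ^+ 2 - h ^+ 3], at [h = eta / 24] it exceeds -2 by at most
   [eta ^+ 2 / 192]. *)
have [||t1 [Tt1 t1t ut1 ugt]] :=
  @last_time_le _ (u j) T t (-1 + eta / 24) (@u_cont j) Tt; first by lra.
  by rewrite /foot in uf; lra.
have t1T : T < t1 by rewrite lt_neqAle Tt1 andbT; apply/eqP => E; rewrite E in uT; lra.
have t1pos : 0 < t1 by lra.
have : 0 <= gamma j * (cubic (u j t1) + 3 * clip (y j t1)).
  apply: (derive_ge0_right (u_ode j t1pos) (e := t - t1)); first by lra.
  by move=> s sI; rewrite ut1 ltW// ugt; lra.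
rewrite pmulr_rge0// ut1 => cl_ge.
have e2 := eta2; have cl1 : 2 / 3 - eta ^+ 2 / 192 <= clip (y j t1).
  suff : cubic (-1 + eta / 24) <= -2 + eta ^+ 2 / 192 by lra.
  have -> : cubic (-1 + eta / 24) =
    -2 + eta ^+ 2 / 192 - eta ^+ 2 * eta / 13824 by rewrite /cubic; field.
  suff : 0 <= eta ^+ 2 * eta by lra.
  by rewrite mulr_ge0; lra.
have y1 : 2 / 3 - eta ^+ 2 / 192 <= y j t1.
  have cl2 : -1 < clip (y j t1) by lra.
  exact: le_trans cl1 (clip_le cl2).
have := @retreat j t1 t _ _ good _ y1; rewrite Tt1 (ltW t1t).
move=> /(_ isT ltac:(lra)); have [] := delta_loss j; lra.
Qed.

Lemma on_course_resting i t : T <= t ->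
  (forall s, T <= s < t -> on_course s /\ unfinished s) ->
  ~~ C i -> 1 <= u i t.
Proof.
move=> Tt good Ci; have [uT yT] := init_resting Ci; have T0 := T_ge0.
apply: (u_upward (s := T)) => // [|r rI]; first by lra.
have := @retreat i T r _ _ _ _ yT; rewrite lexx => /(_ ltac:(lra)).
have [] := delta_loss i; have := eta2 => e2 d1 d2 /(_ _ ltac:(lra)) H.
suff : 1 / 2 - delta i * v0 <= y i r by lra.
by apply: H => s sI; apply: good; lra.
Qed.

Lemma on_course_near t : (forall j, C j -> foot <= u j t ->
    2 / 3 - eta ^+ 2 / 96 < y j t) -> (forall i, ~~ C i -> 1 <= u i t) ->
  exists2 e, 0 < e & forall s, `|s - t| < e -> on_course s.
Proof.
move=> cC cN.
pose G i s := (C i -> foot <= u i s -> 2 / 3 - eta ^+ 2 / 96 < y i s) /\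
  (~~ C i -> 1 - eta < u i s).
have : \forall s \near t, forall i, G i s.
  apply: (@filter_forall _ _ G (nbhs t)) => i; rewrite /G; case Ci : (C i); last first.
    have ui : 1 - eta < u i t.
      by have := cN i; rewrite Ci => /(_ isT); have e := eta_bounds; lra.
    by apply: filterS (cvgr_gt _ (@u_cont i t) _ ui) => s us; split.
  have [uf|uf] := leP foot (u i t).
    by apply: filterS (cvgr_gt _ (@y_cont i t) _ (cC i Ci uf)) => s us; split.
  apply: filterS (cvgr_lt _ (@u_cont i t) _ uf) => s us; split=> // _.
  by rewrite leNgt us.
move=> /nbhs_ballP[e /= e0 He]; exists e => // s st.
have {}He : forall i, _ := He s _; rewrite /ball /= distrC in He.
by split=> i Ci; have [] := He st i; auto.
Qed.

(** Real induction closes the circle: the invariant before [t] feeds [retreat], which gives the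
    invariant at [t] with room to extend it. *)
Lemma course T1 : (forall s, T <= s < T1 -> unfinished s) ->
  forall t, T <= t <= T1 -> on_course t /\ forall i, ~~ C i -> 1 <= u i t.
Proof.
move=> unf; have oc : forall t, T <= t <= T1 -> on_course t.
  apply: real_induction => t tI ocs.
  have good s : T <= s < t -> on_course s /\ unfinished s.
    by move=> sI; split; [exact: ocs|apply: unf; lra].
  have Tt : T <= t by lra.
  have [j|i|e e0 He] := @on_course_near t.
  - exact: on_course_moving.
  - exact: on_course_resting.
  - by exists e => // s sI; apply: He; rewrite ltr_norml; lra.
move=> t tI; split=> [|i]; first exact: oc.
apply: on_course_resting; first by lra.
by move=> s sI; split; [apply: oc; lra|apply: unf; lra].
Qed.

Lemma resting_forever t i : (forall j, ~~ C j) -> T <= t -> 1 <= u i t.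
Proof.
move=> C0 Tt; have := @course t _ t; rewrite Tt lexx => -[|//|_]; last exact.
by move=> s _; right.
Qed.

Lemma crossing j t : 0 <= t -> on_course t -> C j -> foot <= u j t <= 7 / 4 ->
  0 < gamma j * (cubic (u j t) + 3 * clip (y j t)).
Proof.
move=> t0 [ct _] Cj uI; rewrite mulr_gt0//.
apply: lt_le_trans (escape_rate eta_bounds _ (ct j Cj _)).
- by rewrite divr_gt0// exprn_gt0//; case/andP: eta_bounds.
- by rewrite /foot in uI; lra.
- by lra.
Qed.

(** In a stage without end, [gain] lifts [y j] to 1, [retreat] then keeps it above 9 / 10, and below
    1 the coordinate [u j] rises at speed at least [7 / 10 * gamma j], where 7 / 10 is
    [-2 + 3 * (9 / 10)]. *)
Lemma eventually_crossed j : C j ->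
  (forall t, T <= t -> unfinished t) -> exists t1, forall t, t1 <= t -> 1 <= u j t.
Proof.
move=> Cj unf; have T0 := T_ge0; have d0 := delta_gt0 j; have g0 := gamma_gt0 j.
have good t : T <= t -> on_course t /\ unfinished t.
  move=> Tt; split; last exact: unf.
  have := @course t _ t; rewrite Tt lexx => -[||//] //.
  by move=> s /andP[Ts _]; apply: unf.
(* Long enough for [gain] to yield a rise by 4, from at least -3 to at least 1. *)
pose th := 8 / delta j + 2 * v0.
have th0 : 0 < th.
  apply: ltr_wpDr; last by apply: divr_gt0.
  by apply: mulr_ge0; [rewrite ler0n|exact: v0_ge0].
have [t0 [Tt0 yt0]] : exists t0, T <= t0 /\ 1 <= y j t0.
  apply: contrapT => no; have ylt t : T <= t -> y j t < 1.
    by move=> Tt; rewrite ltNge; apply/negP => yt; apply: no; exists t.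
  have := @gain j T (T + th); rewrite lexx /= lerDl (ltW th0).
  move=> /(_ isT) H; have := ylt (T + th); rewrite lerDl (ltW th0) => /(_ isT).
  have E : delta j * ((T + th - T) / 2 - v0) = 4.
    by rewrite /th; field; exact: lt0r_neq0.
  rewrite {}E in H; have := y_box j T_ge0; have : y j T + 4 <= y j (T + th); last lra.
  apply: H => t tI; first by apply: good; lra.
  by apply/ltW/(lt_trans (ylt t _)); lra.
have y_ge t : t0 <= t -> 9 / 10 <= y j t.
  move=> t0t; have := @retreat j t0 t 1; rewrite Tt0 t0t => /(_ isT) H.
  have := eta2; have [] := delta_loss j; have : 1 - delta j * v0 <= y j t; last lra.
  by apply: H => // [s sI|]; [apply: good|]; lra.
pose th' := 40 / (7 * gamma j).
have th'0 : 0 < th' by apply: divr_gt0; [rewrite ltr0n|apply: mulr_gt0].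
have [t1 [t01 ut1]] : exists t1, t0 <= t1 /\ 1 <= u j t1.
  apply: contrapT => no; have ult t : t0 <= t -> u j t < 1.
    by move=> Tt; rewrite ltNge; apply/negP => ut; apply: no; exists t.
  pose F s := u j s - 7 / 10 * gamma j * s.
  have : F t0 <= F (t0 + th').
    apply: nondecreasing_derive => [s||s sI]; last 1 first.
    - have s0 : 0 < s by lra.
      exists (gamma j * (cubic (u j s) + 3 * clip (y j s)) - 7 / 10 * gamma j * 1).
        have d1 := @is_deriveZ _ _ _ id (7 / 10 * gamma j) _ _ _ (is_derive_id s (1 : R)).
        exact: is_deriveB (u_ode j s0) d1.
      have -> (c : R) : gamma j * c - 7 / 10 * gamma j * 1 = gamma j * (c - 7 / 10) by ring.
      apply: mulr_ge0; first exact: ltW.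
      have : 9 / 10 <= clip (y j s) by apply: clip_ge; [lra|apply: y_ge; lra].
      have : u j s < 1 by apply: ult; lra.
      by move=> us1; have := @cubic_ge R (u j s); lra.
    - apply: cvgB; first exact: u_cont.
      by apply: cvgM; [exact: cvg_cst|exact: cvg_id].
    - by lra.
  have : u j (t0 + th') < 1 by apply: ult; lra.
  have t00 : 0 <= t0 by lra.
  have := u_box j t00.
  suff : 7 / 10 * gamma j * th' = 4 by rewrite /F mulrDr; lra.
  by rewrite /th'; field; exact: lt0r_neq0.
exists t1 => t t1t; apply: (u_upward (s := t1)) => // [|r rI]; first by lra.
by have : 9 / 10 <= y j r; [apply: y_ge|]; lra.
Qed.

(** The end is the first time at which every crossing coordinate is at least 1, an infimum attained
    by continuity. If there were no such time, the stage would be unfinished forever and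
    [eventually_crossed], applied to all of them, would produce one. *)
Lemma stage_finishes j0 : C j0 ->
  exists T1, [/\ T <= T1, forall j, C j -> 1 <= u j T1 &
    forall t, T <= t < T1 -> unfinished t].
Proof.
move=> Cj0; pose B := [set t | T <= t /\ forall j, C j -> 1 <= u j t].
have unfB t : T <= t -> ~ B t -> unfinished t.
  move=> Tt nB; apply: contrapT => nu; apply: nB; split=> // j Cj.
  by rewrite leNgt; apply/negP => uj; apply: nu; left; exists j.
have B0 : B !=set0.
  apply: contrapT => noB; have unf t : T <= t -> unfinished t.
    by move=> Tt; apply: unfB => // Bt; apply: noB; exists t.
  pose G j t := C j -> 1 <= u j t.
  have : \forall t \near +oo, T <= t /\ forall j, G j t.
    apply: filterI; first by apply: nbhs_pinfty_ge; exact: num_real.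
    apply: (@filter_forall _ _ G (nbhs +oo)) => j.
    have [Cj|nCj] := boolP (C j); last by apply: nearW => t Cj; rewrite Cj in nCj.
    have [t1 ut1] := eventually_crossed Cj unf.
    by near=> t => _; apply: ut1; near: t; apply: nbhs_pinfty_ge; exact: num_real.
  by case/filter_ex => t [Tt Gt]; apply: noB; exists t.
have infB : has_inf B by split=> //; exists T => t [].
have TB : T <= inf B by apply: lb_le_inf => // t [].
have below t : T <= t < inf B -> ~ B t.
  by move=> tI Bt; have := ge_inf infB.2 Bt; lra.
exists (inf B); split=> // [j Cj|t tI]; last by apply: unfB; [lra|exact: below].
rewrite leNgt; apply/negP => /(continuous_lt (@u_cont j))[e e0 He].
have [t Bt te] := inf_adherent e0 infB; have := ge_inf infB.2 Bt => Bt'.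
have := Bt.2 j Cj; suff : u j t < 1 by lra.
by apply: He; rewrite ltr_norml; lra.
Unshelve. all: by end_near. Qed.

(** The bounds at [T1] are the initial form of the next stage, and the duration of at least 1 keeps
    stages from accumulating. *)
Lemma stage : ((forall j, ~~ C j) -> forall t i, T <= t -> 1 <= u i t) /\
  (forall j0, C j0 -> exists T1, [/\ T + 1 <= T1,
    forall i, 1 <= u i T1 /\ 1 / 2 <= y i T1,
    forall i, ~~ C i -> forall t, T <= t <= T1 -> 0 < u i t &
    forall j, C j -> exists c, [/\ T < c < T1, u j c = 0,
      forall t, T <= t < c -> u j t < 0 & forall t, c < t <= T1 -> 0 < u j t]]).
Proof.
split=> [C0 t i|j0 Cj0]; first exact: resting_forever.
have [T1 [TT1 uT1 unf]] := stage_finishes Cj0.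
have T0 := T_ge0; have e2 := eta2.
have oc := course unf.
have good t : T <= t < T1 -> on_course t /\ unfinished t.
  by move=> tI; split; [apply: (oc t _).1; lra|exact: unf].
have yC j : C j -> 1 / 2 <= y j T1.
  move=> Cj; have : foot <= u j T1 by have := uT1 j Cj; have := foot_le; lra.
  by move=> uf; have [[/(_ j Cj uf)]] := oc T1 (introT andP (conj TT1 (lexx _))); lra.
(* The slow variable of [j0] has to climb from at most -1 / 2 to at least 1 / 2 at speed at most
   [21 * delta j0], which is small. *)
have long : 2 * (v0 + 1) <= T1 - T.
  have d0 := delta_gt0 j0; have dv := delta_v0 j0; have v0' := v0_ge0.
  pose F s := 21 * delta j0 * s - y j0 s.
  have : F T <= F T1.
    apply: nondecreasing_derive => // [s|s sI].
      apply: cvgB; last exact: y_cont.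
      by apply: cvgM; [exact: cvg_cst|exact: cvg_id].
    have s0 : 0 < s by lra.
    exists (21 * delta j0 * 1 - delta j0 * (cubic (y j0 s) + 3 * w j0 s)).
      have d1 := @is_deriveZ _ _ _ id (21 * delta j0) _ _ _ (is_derive_id s (1 : R)).
      exact: is_deriveB d1 (y_ode j0 s0).
    have -> (c : R) : 21 * delta j0 * 1 - delta j0 * c = delta j0 * (21 - c) by ring.
    apply: mulr_ge0; first exact: ltW.
    by have := cubic_bounds (y_box j0 (ltW s0)); have := w_box j0 s; lra.
  have := yC j0 Cj0; have := (init_moving Cj0).2; rewrite /F => yT yT1 FF.
  have {FF} : 1 <= 21 * (delta j0 * (T1 - T)) by lra.
  move=> gap; rewrite leNgt; apply/negP => short.
  have : delta j0 * (T1 - T) <= delta j0 * (2 * (v0 + 1)) by rewrite ler_pM2l//; lra.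
  by rewrite mulrCA; lra.
have v0' := v0_ge0.
exists T1; split=> [|i|i Ci t tI|j Cj]; first by lra.
- have [Ci|Ci] := boolP (C i); first by split; [exact: uT1|exact: yC].
  split; first by apply: (oc T1 _).2 => //; lra.
  have d0 := delta_gt0 i.
  (* A resting slow variable that ever reaches 1 stays above 1 / 2 by [retreat]. Otherwise [gain]
     applies throughout, and the stage is long enough for the drift to make up for [v0]. Hence
     losses do not add up over the stages. *)
  have [[t0 [t0I yt0]]|no] := pselect (exists t0, T <= t0 <= T1 /\ 1 <= y i t0).
    have [_ dl] := delta_loss i.
    have := @retreat i t0 T1 1 t0I good; move=> /(_ ltac:(lra) yt0); lra.
  have := @gain i T T1; rewrite lexx TT1 => /(_ isT good) H.
  have : 0 <= delta i * ((T1 - T) / 2 - v0) by rewrite mulr_ge0 ?(ltW d0)//; lra.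
  suff : y i T + delta i * ((T1 - T) / 2 - v0) <= y i T1.
    by have := (init_resting Ci).2; lra.
  apply: H => t tI; apply: ltW; apply: (@lt_trans _ _ 1); last by lra.
  by rewrite ltNge; apply/negP => yt; apply: no; exists t; split=> //; lra.
- by apply: lt_le_trans ltr01 _; apply: (oc t tI).2.
have uT := (init_moving Cj).1; have u1 := uT1 j Cj.
have [c cI uc] : exists2 c, c \in `[T, T1] & u j c = 0.
  apply: IVT => //; first exact/continuous_subspaceT/u_cont.
  by rewrite ge_min le_max; apply/andP; split; apply/orP; [left|right]; lra.
have {cI}[Tc cT1] : T <= c /\ c <= T1 by move: cI; rewrite in_itv /= => /andP.
have Tc' : T < c by rewrite lt_neqAle Tc andbT; apply/eqP => E; rewrite E in uT; lra.
have c1' : c < T1 by rewrite lt_neqAle cT1 andbT; apply/eqP => E; rewrite E in uc; lra.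
(* At level 0 the coordinate is past [foot] and rises strictly, so it cannot return: the zero is
   unique. *)
have up a b : T <= a < b -> b <= T1 -> 0 <= u j a -> 0 < u j b.
  move=> abI bT ua.
  apply: (@barrier_lt _ (u j) a b 0 (1 / 2)) => //; first by lra.
  move=> t tI utI; have t0 : 0 < t by lra.
  eexists; first exact: (u_ode j t0).
  apply: crossing => //; [exact: ltW|by apply: (oc t _).1; lra|].
  by have := foot_le; lra.
exists c; split=> [|//|t tI|t tI]; first by lra.
  rewrite ltNge; apply/negP => ut; have := up t c tI cT1 ut.
  by rewrite uc ltxx.
by apply: (up c t); [lra|lra|rewrite uc].
Qed.

End Stage.

(** * From zeros to the Boolean sequence *)

Section SwitchingSequence.
Variables (R : realType) (E : topologicalType) (n : nat).
Variables (M : set E) (S : E -> state n) (x : R -> E) (f : state n -> state n).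
Variables (Z : set R) (allowed : state n -> state n -> Prop).
Hypothesis Z_gt0 : forall z, Z z -> 0 < z.
Hypothesis Z_fin : forall b, exists r : seq R, forall z, Z z -> z <= b -> z \in r.
Hypothesis Z_const : forall a b : R, 0 <= a <= b ->
  (forall z, a <= z <= b -> ~ Z z) -> S (x a) = S (x b).
Hypothesis Z_switch : forall u : R, 0 <= u -> ~ Z u -> ~ switching_set M S (x u).
Hypothesis Z_jump : forall z, Z z -> exists a b,
  [/\ \forall u \near z^'-, S (x u) = a, \forall u \near z^'+, S (x u) = b,
      a <> b & allowed a b].
Hypothesis Z_end : forall u : R, 0 <= u -> (forall z, Z z -> z <= u) ->
  forall t, u < t -> f (S (x t)) = S (x t).

Let later (u : R) := exists2 z, Z z & u < z.
Let next_switch (u z : R) := [/\ Z z, u < z & forall z', Z z' -> u < z' -> z <= z'].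

Let seq_min (P : R -> Prop) (r : seq R) z : z \in r -> P z ->
  exists2 m, P m & forall z', z' \in r -> P z' -> m <= z'.
Proof.
elim: r z => // y r IH z zr Pz; have [[z1 z1r Pz1]|no] := pselect (exists2 z, z \in r & P z).
  have [m Pm mle] := IH _ z1r Pz1.
  have [[Py ym]|nym] := pselect (P y /\ y < m).
    exists y => // z'; rewrite inE => /predU1P[->//|z'r Pz'].
    by rewrite (le_trans (ltW ym))// mle.
  exists m => // z'; rewrite inE => /predU1P[-> Py|]; last exact: mle.
  by rewrite leNgt; apply/negP => ym; apply: nym.
move: zr; rewrite inE => /predU1P[E0|zr]; last by case: no; exists z.
exists z => // z'; rewrite inE => /predU1P[->|z'r Pz']; first by rewrite E0.
by case: no; exists z'.
Qed.

Let next_switchP u : later u -> exists z, next_switch u z.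
Proof.
move=> [z1 Zz1 uz1]; have [r Zr] := Z_fin z1.
have [//|m [Zm um] mle] := @seq_min (fun z => Z z /\ u < z) r z1 (Zr _ Zz1 (lexx _)).
exists m; split=> // z' Zz' uz'; have [z'1|/ltW z'1] := leP z' z1.
  by apply: mle => //; apply: Zr.
by apply: le_trans z'1; apply: mle => //; apply: Zr.
Qed.

(** The default [u + 1] keeps the sequence strictly increasing after the last switch, so that it can
    be used at every index. *)
Let t (k : nat) : R := iter k (fun u => xget (u + 1) (next_switch u)) 0.

Let tS k : t k.+1 = xget (t k + 1) (next_switch (t k)). Proof. by []. Qed.

Let t_next k : later (t k) -> next_switch (t k) (t k.+1).
Proof. by move=> /next_switchP[z]; rewrite tS; exact: xgetI. Qed.

Let t_last k : ~ later (t k) -> t k.+1 = t k + 1.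
Proof.
move=> no; rewrite tS; case: xgetP => // z _ [Zz tz _].
by case: no; exists z.
Qed.

Let t_incr k : t k < t k.+1.
Proof.
have [/t_next[]//|/t_last ->] := pselect (later (t k)).
by rewrite ltrDl.
Qed.

Let t_mono : {homo t : i j / (i <= j)%N >-> i <= j}.
Proof. by apply/nondecreasing_seqP => k; exact: ltW. Qed.

Let t_ge0 k : 0 <= t k. Proof. exact: (t_mono (leq0n k)). Qed.

(** If all terms stayed below [b], the list [r] would contain more distinct switches than it has
    entries. *)
Let t_unbounded : (forall k, later (t k)) -> t @ \oo --> +oo.
Proof.
move=> lat; apply/cvgryPge => b; have [r Zr] := Z_fin b.
have [k tk] : exists k, b < t k.
  apply: contrapT => no; have tb k : t k <= b.
    by rewrite leNgt; apply/negP => bt; apply: no; exists k.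
  pose s := [seq t k.+1 | k <- iota 0 (size r).+1].
  have su : uniq s.
    rewrite map_inj_in_uniq ?iota_uniq// => i j _ _ tij.
    apply/eqP; rewrite eqn_leq; apply/andP; split; rewrite leqNgt; apply/negP => ij.
      by have := le_lt_trans (t_mono ij) (t_incr i.+1.-1); rewrite tij ltxx.
    by have := le_lt_trans (t_mono ij) (t_incr j.+1.-1); rewrite tij ltxx.
  have sr : {subset s <= r}.
    move=> _ /mapP[k _ ->]; apply: Zr; last exact: tb.
    by have [] := t_next (lat k).
  by have := uniq_leq_size su sr; rewrite size_map size_iota ltnn.
near=> j; apply: le_trans (ltW tk) _; apply: t_mono.
by near: j; exact: nbhs_infty_ge.
Unshelve. all: by end_near. Qed.

Lemma switching_sequence : exists K t, Defs.transversal M S x K t /\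
  forall tau, let sx := boolean_sequence S x K t in
    (sx tau <> sx tau.+1 /\ allowed (sx tau) (sx tau.+1)) \/
    (sx tau.+1 = sx tau /\ f (sx tau) = sx tau).
Proof.
(* The entry [t 0] is the time 0 and no switch, so [m] switches make the length [m.+1]; [m] is the
   least index with no later switch. *)
have [K [K0 K_later K_end]] : exists K : option nat, [/\ below K 0,
    forall k, below K k -> below K k.+1 <-> later (t k) &
    K = None -> forall k, later (t k)].
  have [lat|] := pselect (forall k, later (t k)); first by exists None.
  move=> /existsNP no; have no' : exists k, `[< ~ later (t k) >].
    by case: no => k ?; exists k; apply/asboolP.
  case: (ex_minnP no') => m /asboolP nm mle; exists (Some m.+1); split=> // k km.
  rewrite /= in km *; rewrite ltnS; split=> [{}km|lat].
    apply: contrapT => nk; suff : (m <= k)%N by rewrite leqNgt km.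
    by apply: mle; apply/asboolP.
  rewrite ltn_neqAle -ltnS km andbT; apply/eqP => E0.
  by rewrite E0 in lat.
have below_le k : below K k.+1 -> below K k by case: (K) => //= m /ltnW.
have gap k u : below K k -> t k < u -> (u%:E < switch_time K t k.+1)%E -> ~ Z u.
  move=> bk tu; rewrite /switch_time; case: ifPn => [bk1|nbk1].
    rewrite lte_fin => ut Zu; have /(K_later k bk) lat := bk1.
    by have [_ _ /(_ u Zu tu)] := t_next lat; rewrite leNgt ut.
  move=> _ Zu; move/negP: nbk1; apply; apply/(K_later k bk).
  by exists u.
pose v k := S (x ((t k + t k.+1) / 2)).
have vE k u : below K k -> t k < u -> (u%:E < switch_time K t k.+1)%E ->
    S (x u) = v k.
  move=> bk tu ut; have ti := t_incr k; have t0 := t_ge0 k.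
  have mt : ((((t k + t k.+1) / 2)%R)%:E < switch_time K t k.+1)%E.
    rewrite /switch_time; case: ifP => _; last exact: ltry.
    by rewrite lte_fin; lra.
  have [um|mu] := leP u ((t k + t k.+1) / 2).
    apply: Z_const => [|z zI]; first by lra.
    apply: (gap k) => //; first by lra.
    by apply: le_lt_trans mt; rewrite lee_fin; lra.
  apply/esym/Z_const => [|z zI]; first by lra.
  apply: (gap k) => //; first by lra.
  by apply: le_lt_trans ut; rewrite lee_fin; lra.
have Zt k : below K k.+1 -> Z (t k.+1).
  by move=> bk; have /(K_later k (below_le k bk)) /t_next[] := bk.
have jump k : below K k.+1 -> [/\ \forall u \near (t k.+1)^'-, S (x u) = v k,
    \forall u \near (t k.+1)^'+, S (x u) = v k.+1, v k <> v k.+1 & allowed (v k) (v k.+1)].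
  move=> bk; have ti := t_incr k; have [a [b [xa xb ab mab]]] := Z_jump (Zt k bk).
  have lk : \forall u \near (t k.+1)^'-, S (x u) = v k.
    near=> u; apply: vE; first exact: below_le.
      by near: u; exact: nbhs_left_gt.
    by rewrite /switch_time bk lte_fin.
  have rk : \forall u \near (t k.+1)^'+, S (x u) = v k.+1.
    near=> u; apply: vE => //.
    rewrite /switch_time; case: ifP => _; last exact: ltry.
    by rewrite lte_fin; near: u; apply: nbhs_right_lt; exact: t_incr.
  have -> : v k = a.
    case: (@filter_ex _ _ (at_left_proper_filter (t k.+1)) _ (filterI lk xa)).
    by move=> u [ua ub]; rewrite -ua -ub.
  have -> : v k.+1 = b.
    case: (@filter_ex _ _ (at_right_proper_filter (t k.+1)) _ (filterI rk xb)).
    by move=> u [ua ub]; rewrite -ua -ub.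
  by split.
exists K, t; split.
  split; first by split=> // k _; exact: t_incr.
  split=> //.
  - move=> u u0 ut; apply: Z_switch => //; move: u0; rewrite le_eqVlt.
    by move=> /predU1P[<- /Z_gt0|u0]; [rewrite ltxx|exact: (gap 0%N)].
  - move=> k u bk tu ut; apply: Z_switch; last exact: (gap k).
    by rewrite (le_trans (t_ge0 k))// ltW.
  - move=> [//|k] _ bk; have [l r vv _] := jump k bk.
    by exists (v k), (v k.+1).
  - by move=> /K_end; exact: t_unbounded.
move=> tau /=; rewrite /boolean_sequence.
(* From index [m] on, [boolean_sequence] samples at [t m + tau.+1], and all these points see the
   final state. *)
have tail m : K = Some m.+1 -> forall s, 0 < s -> S (x (t m + s)) = v m.
  move=> KE s s0; apply: vE; rewrite ?KE /switch_time /= ?ltnSn ?ltnn ?ltry//.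
  by rewrite ltrDl.
case KE: K K0 => [[//|m]|] _ /=; last first.
  by left; have [|_ _ vv mv] := jump tau; [rewrite KE|].
rewrite !ltnS; have [tm|mt] := ltnP tau m.
  have [|_ _ vv mv] := jump tau; first by rewrite KE /= ltnS.
  (* For [tau.+1 = m] the next sample already lies in the final, unbounded interval. *)
  left; case: ltnP => tm'; first by split.
  have {tm'}E0 : m = tau.+1 by apply/eqP; rewrite eqn_leq tm tm'.
  by rewrite (tail m KE) // E0.
rewrite ltnNge (leq_trans mt (leqnSn _)) /= !tail//; right; split=> //.
have lastZ z : Z z -> z <= t m.
  move=> Zz; rewrite leNgt; apply/negP => tz.
  have bm : below K m by rewrite KE /= ltnSn.
  have := (K_later m bm).2; rewrite KE /= ltnn => H.
  by have /H : later (t m) by exists z.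
by rewrite -(tail m KE 1)//; apply: (Z_end (t_ge0 m) lastZ); rewrite ltrDl.
Unshelve. all: by end_near. Qed.

End SwitchingSequence.

(** * From the values of [Q] on the open wells to neighbourhoods of the closed ones *)

Section Conversion.
Variables (R : realType) (n : nat) (f : state n -> state n).
Variable (Q : 'rV[R]_n -> 'rV[R]_n).
Hypothesis Qconv : continuous_conversion f Q.

Definition near_well (eta : R) (s : state n) (x : 'rV[R]_n) :=
  forall i, if s i then 1 - eta <= x 0 i else x 0 i <= -1 + eta.

(** Stretching a point of the closed well by [1 + d] moves it into the open one, where [Q] is
    prescribed; continuity gives the value as [d] tends to 0. *)
Lemma conversion_closed_well (s : state n) (x : 'rV[R]_n) i :
  near_well 0 s x -> Q x 0 i = (f s i)%:R.
Proof.
move=> sx; have [Qc _ QW] := Qconv.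
have cv : Q ((1 + d) *: x) 0 i @[d --> (0 : R)^'+] --> Q x 0 i.
  apply: cvg_at_right_filter.
  have -> : Q x 0 i = Q ((1 + 0) *: x) 0 i by rewrite addr0 scale1r.
  apply: (@continuous_comp _ _ _ (fun d : R => Q ((1 + d) *: x)) (fun v => v 0 i));
    last exact: coord_continuous.
  apply: (@continuous_comp _ _ _ (fun d : R => (1 + d) *: x) Q); last exact: Qc.
  apply: cvgZr_tmp; apply: cvgD; [exact: cvg_cst|exact: cvg_id].
apply: (@cvg_unique _ _ ((Q ((1 + d) *: x) 0 i) @[d --> (0 : R)^'+])) => //.
apply: cvg_near_cst; near=> d; apply: QW => j; rewrite mxE.
have d0 : 0 < d by [].
by have := sx j; case: (s j) => ?; nra.
Unshelve. all: by end_near. Qed.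

(** Compactness of the box makes [eta] uniform. The error 1 / 12 in [Q] is 1 / 6 in [2 * Q - 1],
    whence the 5 / 6 of a stage. *)
Lemma conversion_near_well : exists2 eta, 0 < eta <= 1 / 2 &
  forall (s : state n) (x : 'rV[R]_n), (forall i, -3 <= x 0 i <= 3) ->
    near_well eta s x -> forall i, `|Q x 0 i - (f s i)%:R| <= 1 / 12.
Proof.
have [Qc _ _] := Qconv.
pose K := [set x : 'rV[R]_n | forall i, `[-3, 3]%classic (x ord0 i)].
have Kc : compact K.
  have := @rV_compact R n (fun=> `[-3, 3]%classic) (fun=> @segment_compact R _ _).
  exact.
pose P s eta (x : 'rV[R]_n) := near_well eta s x ->
  forall i, `|Q x 0 i - (f s i)%:R| <= 1 / 12.
have : \forall eta \near (0 : R)^'+, forall s, K `<=` P s eta.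
  apply: (@filter_forall _ _ (fun s eta => K `<=` P s eta) ((0 : R)^'+)) => s.
  (* Near a point of the closed well the estimate is continuity of [Q]. Near any other point some
     coordinate misses the well by a fixed amount, so [near_well] fails for small [eta]. *)
  move: Kc => /compact_near_coveringP; apply => x Kx.
  have [sx|] := pselect (near_well 0 s x).
    have : \forall x' \near x, forall i, `|Q x 0 i - Q x' 0 i| <= 1 / 12.
      apply: (@filter_forall _ _
        (fun i x' => `|Q x 0 i - Q x' 0 i| <= 1 / 12) (nbhs x)) => i.
      have : Q x' 0 i @[x' --> x] --> Q x 0 i.
        apply: (@continuous_comp _ _ _ Q (fun v => v 0 i)); first exact: Qc.
        exact: coord_continuous.
      by move=> /cvgrPdist_le; apply; rewrite divr_gt0.
    move=> Qx; near=> x' d => _ i.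
    have Qx' : forall i, `|Q x 0 i - Q x' 0 i| <= 1 / 12 by near: x'.
    by rewrite -(conversion_closed_well i sx) distrC.
  move=> /existsNP[i]; case si: (s i) => /= /negP; rewrite ?subr0 ?addr0 -ltNge => xi.
    near=> x' d => /(_ i); rewrite si /= => wx'.
    have x'i : x' 0 i < (1 + x 0 i) / 2.
      by near: x'; apply: (cvgr_lt _ (@coord_continuous _ _ _ 0 i x)); lra.
    have di : d < (1 - x 0 i) / 2 by near: d; apply: nbhs_right_lt; lra.
    exfalso; lra.
  near=> x' d => /(_ i); rewrite si /= => wx'.
  have x'i : (-1 + x 0 i) / 2 < x' 0 i.
    by near: x'; apply: (cvgr_gt _ (@coord_continuous _ _ _ 0 i x)); lra.
  have di : d < (1 + x 0 i) / 2 by near: d; apply: nbhs_right_lt; lra.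
  exfalso; lra.
move=> Peta.
have : \forall eta \near (0 : R)^'+, 0 < eta /\ eta <= 1 / 2 /\ forall s, K `<=` P s eta.
  near=> eta; split; first by [].
  by split; [near: eta; apply: nbhs_right_le; lra|near: eta].
case/(@filter_ex _ _ (at_right_proper_filter (0 : R))) => eta [e0 [e1 KP]].
exists eta; first by rewrite e0 e1.
by move=> s x x3 sx; apply: (KP s) => // i /=; rewrite in_itv.
Unshelve. all: by end_near. Qed.
End Conversion.

(** * Trajectories of the flow *)

Section Box.
Variable R : realType.

Lemma field_cubic (x y : R) : g x + 6 * L y = cubic x + 3 * clip y.
Proof.
by rewrite /g /L /cubic /clip; case: (leP y (-1)); case: (ltP y 1); lra.
Qed.

Lemma xminus_bounds : -3 < xminus R < -2.
Proof.
have := (@g_eq0 R (xminus R)).2 erefl; set z : R := xminus R; rewrite /g => gz.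
apply/andP; split; rewrite ltNge; apply/negP => zz.
  have : 0 <= (-3 - z) * ((z - 3 / 2) ^+ 2 + 15 / 4).
    by rewrite mulr_ge0//; [lra|rewrite addr_ge0 ?sqr_ge0//; lra].
  have -> : (-3 - z) * ((z - 3 / 2) ^+ 2 + 15 / 4) = 3 * z - z ^+ 3 - 18 by field.
  lra.
have : 0 <= (z - 1) ^+ 2 * (z + 2) by rewrite mulr_ge0 ?sqr_ge0//; lra.
have -> : (z - 1) ^+ 2 * (z + 2) = z ^+ 3 - 3 * z + 2 by ring.
lra.
Qed.

(** From 3 upward the cubic is at most -18, which dominates [3 * v], so the field points inward. The
    round bound 3 replaces the root [xplus]. *)
Lemma upper_box (p v : R -> R) c t : continuous p -> 0 < c ->
  (forall s, -1 <= v s <= 1) ->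
  (forall s : R, 0 < s -> is_derive s 1 p (c * (cubic (p s) + 3 * v s))) ->
  p 0 <= 3 -> 0 <= t -> p t <= 3.
Proof.
move=> pc c0 v1 dp p0 t0; rewrite -lerN2.
apply: (@barrier _ (fun s => - p s) 0 t (-3) 1) => //; last first.
- move=> s s0 ps; have s0' : 0 < s by lra.
  exists (- (c * (cubic (p s) + 3 * v s))); first exact: is_deriveN (dp s s0').
  rewrite oppr_ge0 pmulr_rle0//.
  have : 0 <= (p s - 3) * ((p s + 3 / 2) ^+ 2 + 15 / 4).
    by rewrite mulr_ge0//; [lra|rewrite addr_ge0 ?sqr_ge0//; lra].
  have -> : (p s - 3) * ((p s + 3 / 2) ^+ 2 + 15 / 4) = - 18 - cubic (p s).
    by rewrite /cubic; field.
  by have := v1 s; lra.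
- by lra.
- by move=> s; apply: cvgN; exact: pc.
Qed.

Lemma box (p v : R -> R) c t : continuous p -> 0 < c ->
  (forall s, -1 <= v s <= 1) ->
  (forall s : R, 0 < s -> is_derive s 1 p (c * (cubic (p s) + 3 * v s))) ->
  -3 <= p 0 <= 3 -> 0 <= t -> -3 <= p t <= 3.
Proof.
move=> pc c0 v1 dp p0 t0; apply/andP; split; last first.
  by apply: (upper_box pc c0 v1 dp) => //; lra.
rewrite lerNl; apply: (@upper_box (fun s => - p s) (fun s => - v s) c) => //.
- by move=> s; apply: cvgN; exact: pc.
- by move=> s; have := v1 s; lra.
- move=> s s0; have := is_deriveN (dp s s0) => d; apply: is_derive_eq.
  by rewrite cubicN; ring.
- by lra.
Qed.

End Box.

Definition bsign (R : realType) (b : bool) : R := if b then 1 else -1.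

Section Trajectory.
Variables (R : realType) (n : nat) (f : state n -> state n).
Variables (Q : 'rV[R]_n -> 'rV[R]_n) (gamma : 'rV[R]_(n + n)) (eta gm : R).
Variable (x : R -> 'rV[R]_(n + n)).
Hypothesis Q01 : forall v i, 0 <= Q v 0 i <= 1.
Hypothesis eta_bounds : 0 < eta <= 1 / 2.
Hypothesis Q_near_well : forall (s : state n) (v : 'rV[R]_n),
  (forall i, -3 <= v 0 i <= 3) -> near_well eta s v ->
  forall i, `|Q v 0 i - (f s i)%:R| <= 1 / 12.
Hypothesis gm_gt0 : 0 < gm.
Hypothesis gamma_gt0 : forall j, 0 < gamma 0 j.
Hypothesis gamma_ge : forall i, gm <= gamma 0 (lshift n i).
Hypothesis gamma_lt : forall i, gamma 0 (rshift n i) < stage_mu n eta gm.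
Hypothesis xD : D2 gamma Q x.

(* Extending the trajectory by a constant to negative times makes it continuous
   on the whole line. *)
Let z (t : R) := x (Num.max 0 t).
Local Notation sgn := (@bsign R).
Let p i t := z t 0 (lshift n i).
Let q i t := z t 0 (rshift n i).
Let w i t := 2 * Q (lsubmx (z t)) 0 i - 1.

Let zE t : 0 <= t -> z t = x t.
Proof. by move=> t0; rewrite /z max_r. Qed.

Let z_cont : continuous z.
Proof.
have [_ xc _] := xD => t.
have /subspace_continuousP/(_ (Num.max 0 t)) := xc.
rewrite /= in_itv /= andbT le_max lexx => /(_ isT) xt.
apply: (@cvg_comp _ _ _ (fun s : R => Num.max 0 s) x); last exact: xt.
have mc : Num.max 0 s @[s --> t] --> Num.max 0 t.
  by apply: (@continuous_max R R (cst 0) id); [exact: cvg_cst|exact: cvg_id].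
move=> V /= /mc; apply: (@filterS _ (nbhs t)) => s /=; apply.
by rewrite /= in_itv /= andbT le_max lexx.
Qed.

Let p_cont i : continuous (p i).
Proof.
move=> t; apply: (@continuous_comp _ _ _ z (fun v => v 0 (lshift n i))).
  exact: z_cont.
exact: coord_continuous.
Qed.

Let q_cont i : continuous (q i).
Proof.
move=> t; apply: (@continuous_comp _ _ _ z (fun v => v 0 (rshift n i))).
  exact: z_cont.
exact: coord_continuous.
Qed.

Let p_ode i (t : R) : 0 < t -> is_derive t 1 (p i)
  (gamma 0 (lshift n i) * (cubic (p i t) + 3 * clip (q i t))).
Proof.
move=> t0; have [_ _ /(_ t i t0)[+ _]] := xD.
rewrite field_cubic /p /q zE ?(ltW t0)//; apply: near_eq_is_derive.
by near=> s; rewrite zE// ltW//; near: s; exact: lt_nbhsr.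
Unshelve. all: by end_near. Qed.

Let q_ode i (t : R) : 0 < t -> is_derive t 1 (q i)
  (gamma 0 (rshift n i) * (cubic (q i t) + 3 * w i t)).
Proof.
move=> t0; have [_ _ /(_ t i t0)[_ +]] := xD.
have -> : g (x t 0 (rshift n i)) + 6 * Q (lsubmx (x t)) 0 i =
    cubic (q i t) + 3 * w i t.
  by rewrite /g /w /cubic /q zE ?(ltW t0)//; ring.
apply: near_eq_is_derive; rewrite /q.
by near=> s; rewrite zE// ltW//; near: s; exact: lt_nbhsr.
Unshelve. all: by end_near. Qed.

Let w_box i t : -1 <= w i t <= 1.
Proof. by have := Q01 (lsubmx (z t)) i; rewrite /w; lra. Qed.

Let start_box j : -3 <= z 0 0 j <= 3.
Proof.
rewrite zE//; have [/(_ j)] := xD; rewrite /xplus.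
by have := xminus_bounds R; lra.
Qed.

Let p_box i (t : R) : 0 <= t -> -3 <= p i t <= 3.
Proof.
apply: (box (@p_cont i) (gamma_gt0 _) _ (@p_ode i)); last exact: start_box.
by move=> s; exact: clip_bounds.
Qed.

Let q_box i (t : R) : 0 <= t -> -3 <= q i t <= 3.
Proof.
by apply: (box (@q_cont i) (gamma_gt0 _) _ (@q_ode i)); last exact: start_box.
Qed.

Let sgn_cont b (v : R -> R) : continuous v -> continuous (fun t => sgn b * v t).
Proof. by move=> vc t; apply: cvgM; [exact: cvg_cst|exact: vc]. Qed.

Let sgn_box b (y : R) : -3 <= y <= 3 -> -3 <= sgn b * y <= 3.
Proof. by rewrite /bsign; case: b; lra. Qed.

Let sgn_p_ode (b : state n) i (t : R) : 0 < t -> is_derive t 1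
  (fun s => sgn (b i) * p i s) (gamma 0 (lshift n i) *
    (cubic (sgn (b i) * p i t) + 3 * clip (sgn (b i) * q i t))).
Proof.
move=> t0; apply: is_derive_eq (@is_deriveZ _ _ _ _ (sgn (b i)) _ _ _ (p_ode i t0)) _.
rewrite /GRing.scale /= /bsign; case: (b i); first by rewrite !mul1r.
by rewrite !mulN1r cubicN clipN; ring.
Qed.

Let sgn_q_ode (b : state n) i (t : R) : 0 < t -> is_derive t 1
  (fun s => sgn (b i) * q i s) (gamma 0 (rshift n i) *
    (cubic (sgn (b i) * q i t) + 3 * (sgn (b i) * w i t))).
Proof.
move=> t0; apply: is_derive_eq (@is_deriveZ _ _ _ _ (sgn (b i)) _ _ _ (q_ode i t0)) _.
rewrite /GRing.scale /= /bsign; case: (b i); first by rewrite !mul1r.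
by rewrite !mulN1r cubicN; ring.
Qed.

Let ready (s : state n) T := forall i,
  1 <= sgn (s i) * p i T /\ 1 / 2 <= sgn (s i) * q i T.

Let target_stable (s : state n) := forall s', between s s' (f s) -> f s' = f s.

Let moving (s : state n) : pred 'I_n := fun i => s i != f s i.

Let sgn_neg (a b : bool) : a != b -> sgn a = - sgn b.
Proof. by rewrite /bsign; case: a b => [] [] // _; rewrite opprK. Qed.

(** The state [s'] records the current position: moving coordinates still near their old wells keep
    the value of [s], all others have the target value. It lies between [s] and [f s] and is not
    [f s] while some crossing is unfinished, so stability gives [f s' = f s] and [Q] points at the
    same target. If nothing moves, [s'] is [s]. *)
Let settled (s : state n) t : target_stable s -> 0 <= t ->
  unfinished (moving s) (fun i t => sgn (f s i) * p i t) t ->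
  (forall j, moving s j -> sgn (f s j) * p j t <= -1 + eta \/ 1 <= sgn (f s j) * p j t) ->
  (forall i, ~~ moving s i -> 1 - eta <= sgn (f s i) * p i t) ->
  forall i, 5 / 6 <= sgn (f s i) * w i t.
Proof.
move=> stable t0 unf mov rest i; have e := eta_bounds.
pose s' : state n :=
  [ffun i => if moving s i && (sgn (f s i) * p i t <= -1 + eta) then s i else f s i].
have fs' : f s' = f s.
  case: unf => [[j mj uj]|m0].
    apply: stable; split=> [k sk|E].
      by rewrite ffunE sk; case: ifP.
    have [uj'|] := mov j mj; last by lra.
    have := congr1 (fun s : state n => s j) E; rewrite ffunE mj uj' /= => E'.
    by rewrite /moving E' eqxx in mj.
  suff -> : s' = s by [].
  apply/ffunP => k; rewrite ffunE (negbTE (m0 k)) /=.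
  by have := m0 k; rewrite negbK => /eqP.
have well : near_well eta s' (lsubmx (z t)).
  move=> k; rewrite mxE -/(p k t) ffunE.
  have [mk|mk] := boolP (moving s k) => /=; last first.
    by have := rest k mk; rewrite /bsign; case: (f s k); lra.
  have [uk|uk] := leP (sgn (f s k) * p k t) (-1 + eta).
    have := sgn_neg mk; move: uk; rewrite /bsign.
    by case: (s k); case: (f s k) => /=; lra.
  have [uk'|uk'] := mov k mk; first by lra.
  by move: uk'; rewrite /bsign; case: (f s k); lra.
have inbox k : -3 <= (lsubmx (z t)) 0 k <= 3 by rewrite mxE; exact: p_box.
have := Q_near_well inbox well i; rewrite fs' ler_norml /w /bsign.
by case: (f s i) => /=; lra.
Qed.

Let ready_init s T : ready s T -> forall i,
  if moving s i then sgn (f s i) * p i T <= -1 /\ sgn (f s i) * q i T <= -1 / 2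
  else 1 <= sgn (f s i) * p i T /\ 1 / 2 <= sgn (f s i) * q i T.
Proof.
move=> rdy i; have := rdy i; case: ifPn => [/sgn_neg ->|]; first by lra.
by rewrite negbK => /eqP ->.
Qed.

Let stageP s T : target_stable s -> 0 <= T -> ready s T ->
  ((forall j, ~~ moving s j) -> forall t i, T <= t -> 1 <= sgn (f s i) * p i t) /\
  (forall j0, moving s j0 -> exists T1, [/\ T + 1 <= T1, ready (f s) T1,
    forall i, ~~ moving s i -> forall t, T <= t <= T1 -> 0 < sgn (f s i) * p i t &
    forall j, moving s j -> exists c, [/\ T < c < T1, sgn (f s j) * p j c = 0,
      forall t, T <= t < c -> sgn (f s j) * p j t < 0 &
      forall t, c < t <= T1 -> 0 < sgn (f s j) * p j t]]).
Proof.
move=> stable T0 rdy.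
apply: (@stage R n (moving s) (fun i t => sgn (f s i) * p i t)
  (fun i t => sgn (f s i) * q i t) (fun i t => sgn (f s i) * w i t)
  (fun i => gamma 0 (lshift n i)) (fun i => gamma 0 (rshift n i)) eta gm T).
- exact: eta_bounds.
- exact: gm_gt0.
- exact: gamma_ge.
- by move=> i; exact: gamma_gt0.
- exact: gamma_lt.
- by move=> i; apply: sgn_cont; exact: p_cont.
- by move=> i; apply: sgn_cont; exact: q_cont.
- by move=> i t; exact: sgn_p_ode.
- by move=> i t; exact: sgn_q_ode.
- by move=> i t t0; apply: sgn_box; exact: p_box.
- by move=> i t t0; apply: sgn_box; exact: q_box.
- by move=> i t; have := w_box i t; rewrite /bsign; case: (f s i); lra.
- exact: T0.
- by move=> j mj; have := ready_init rdy j; rewrite mj.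
- by move=> j /negbTE mj; have := ready_init rdy j; rewrite mj.
- by move=> t Tt; apply: settled => //; exact: le_trans Tt.
Qed.

Variable s0 : state n.
Hypothesis s0_stepping : monotone_stepping_trajectory f s0.
Hypothesis start : forall i, 1 < sgn (s0 i) * x 0 0 (lshift n i) /\
  1 < sgn (s0 i) * x 0 0 (rshift n i).

Let Z : set R := [set t | 0 < t /\ exists i, p i t = 0].

(** The second clause carries strong consistency along, so that one analysis of the trajectory
    serves both notions. *)
Let allowed (a b : state n) := (forall i, b i = f a i \/ b i = a i) /\
  (one_stepping_trajectory f s0 -> b = f a).

Let jump (t : R) := exists a b, [/\ \forall u \near t^'-, S2 (x u) = a,
  \forall u \near t^'+, S2 (x u) = b, a <> b & allowed a b].

Let S2E t i : 0 <= t -> S2 (x t) i = (0 < p i t).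
Proof. by move=> t0; rewrite ffunE /p zE. Qed.

Let sgn_gt0 b (v : R) : 0 < sgn b * v -> (0 < v) = b.
Proof.
by rewrite /bsign; case: b => v0; [|apply/negbTE; rewrite -leNgt]; lra.
Qed.

Let sgn_lt0 b (v : R) : sgn b * v < 0 -> (0 < v) = ~~ b.
Proof.
by rewrite /bsign; case: b => v0; [apply/negbTE; rewrite -leNgt|]; lra.
Qed.

(** Every zero in the stage is the crossing time of a moving coordinate, so there are finitely
    many. *)
Let stage_jumps s T : target_stable s -> 0 <= T -> ready s T -> f s <> s ->
  (one_stepping_trajectory f s0 -> (hamming s (f s) <= 1)%N) ->
  exists T1, [/\ T + 1 <= T1, ready (f s) T1,
    exists r : seq R, forall t, Z t -> T <= t <= T1 -> t \in r,
    forall t, Z t -> T <= t <= T1 -> jump t &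
    exists2 t, Z t & T <= t].
Proof.
move=> stable T0 rdy fs one.
have [j0 mj0] : exists j, moving s j.
  apply: contrapT => no; apply: fs; apply/ffunP => j; apply/eqP.
  by rewrite eq_sym; apply/negPn/negP => mj; apply: no; exists j.
have [_ /(_ j0 mj0)[T1 [TT1 rdy1 rest cross]]] := stageP stable T0 rdy.
have /boolp.choice[c cP] : forall j, exists c, moving s j -> [/\ T < c < T1,
    sgn (f s j) * p j c = 0, forall t, T <= t < c -> sgn (f s j) * p j t < 0 &
    forall t, c < t <= T1 -> 0 < sgn (f s j) * p j t].
  move=> j; have [mj|_] := boolP (moving s j); last by exists 0.
  by have [c cP] := cross j mj; exists c.
have zero j t : T <= t <= T1 -> p j t = 0 -> moving s j /\ t = c j.
  move=> tI pt; have mj : moving s j.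
    by apply: contraT => mj; have := rest j mj t tI; rewrite pt mulr0 ltxx.
  split=> //; have [cI pc neg pos] := cP j mj.
  apply/eqP; rewrite eq_le !leNgt; apply/andP; split; apply/negP => tc.
    by have := pos t; rewrite pt mulr0 ltxx => H; suff : false by []; apply: H; lra.
  by have := neg t; rewrite pt mulr0 ltxx => H; suff : false by []; apply: H; lra.
have zero_c j : moving s j -> Z (c j).
  move=> mj; have [cI pc neg pos] := cP j mj; split; first by lra.
  exists j; move: pc; rewrite /bsign; case: (f s j); lra.
exists T1; split=> //.
- exists [seq c j | j <- enum 'I_n] => t [_ [j pj]] tI.
  by have [_ ->] := zero j t tI pj; apply: map_f; rewrite mem_enum.
- move=> t [_ [j pj]] tI; have [mj tc] := zero j t tI pj.
  have tI' : T < t < T1 by have [cI _ _ _] := cP j mj; rewrite tc; lra.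
  (* The states before and after [t]: coordinates crossing exactly at [t] count as unmoved in [a]
     and as moved in [b]. Since [j] is one of them, [a] is not [f s], and stability gives
     [f a = f s]. *)
  pose a : state n := [ffun i => if moving s i && (t <= c i) then s i else f s i].
  pose b : state n := [ffun i => if moving s i && (t < c i) then s i else f s i].
  have fa : f a = f s.
    apply: stable; split=> [k sk|/(congr1 (fun s : state n => s j))].
      by rewrite ffunE sk; case: ifP.
    by rewrite ffunE mj tc lexx /= => /eqP; apply/negP.
  exists a, b; split.
  + suff : \forall u \near t^'-, forall i, S2 (x u) i = a i.
      by apply: filterS => u ua; apply/ffunP.
    apply: (@filter_forall _ _ (fun i u => S2 (x u) i = a i) (t^'-)) => i.
    rewrite ffunE; have [mi|mi] := boolP (moving s i); last first.
      near=> u; have uT : T < u by near: u; apply: nbhs_left_gt; lra.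
      have ut : u < t by [].
      by rewrite S2E; [apply: sgn_gt0; apply: rest => //|]; lra.
    have [_ _ neg pos] := cP i mi; have [tci|cit] := leP t (c i) => /=.
      near=> u; have uT : T < u by near: u; apply: nbhs_left_gt; lra.
      have ut : u < t by [].
      have := @sgn_lt0 (f s i) (p i u); rewrite S2E; last by lra.
      move=> ->; last by apply: neg; lra.
      by have := mi; rewrite /moving; case: (s i); case: (f s i).
    near=> u; have uc : c i < u by near: u; exact: nbhs_left_gt.
    have uT : T < u by near: u; apply: nbhs_left_gt; lra.
    have ut : u < t by [].
    by rewrite S2E; [apply: sgn_gt0; apply: pos|]; lra.
  + suff : \forall u \near t^'+, forall i, S2 (x u) i = b i.
      by apply: filterS => u ua; apply/ffunP.
    apply: (@filter_forall _ _ (fun i u => S2 (x u) i = b i) (t^'+)) => i.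
    rewrite ffunE; have [mi|mi] := boolP (moving s i); last first.
      near=> u; have uT : u < T1 by near: u; apply: nbhs_right_lt; lra.
      have ut : t < u by [].
      by rewrite S2E; [apply: sgn_gt0; apply: rest => //|]; lra.
    have [_ _ neg pos] := cP i mi; have [tci|cit] := ltP t (c i) => /=.
      near=> u; have uc : u < c i by near: u; exact: nbhs_right_lt.
      have ut : t < u by [].
      have := @sgn_lt0 (f s i) (p i u); rewrite S2E; last by lra.
      move=> ->; last by apply: neg; lra.
      by have := mi; rewrite /moving; case: (s i); case: (f s i).
    near=> u; have uT : u < T1 by near: u; apply: nbhs_right_lt; lra.
    have ut : t < u by [].
    by rewrite S2E; [apply: sgn_gt0; apply: pos|]; lra.
  + move=> /(congr1 (fun s : state n => s j)).
    by rewrite !ffunE mj tc lexx ltxx /= => /eqP; apply/negP.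
  split=> [i|/one ham].
    rewrite fa !ffunE; have [mi|mi] := boolP (moving s i) => /=; last by left.
    by have [tci|cit] := ltP t (c i); [right; rewrite (ltW tci)|left].
  rewrite fa; apply/ffunP => i; rewrite ffunE; case: ifP => // /andP[mi].
  have -> : i = j by apply: (card_le1_eqP ham); rewrite inE.
  by rewrite tc ltxx.
- exists (c j0); first exact: zero_c.
  by have [] := cP j0 mj0; lra.
Unshelve. all: by end_near. Qed.

Let covered b := exists r : seq R, forall t, Z t -> t <= b -> t \in r.

Let jumps b := forall t, Z t -> t <= b -> jump t.

(** The bound [m%:R <= T] makes the stages exhaust the time axis, and the last clause gives zeros at
    arbitrarily late times unless the trajectory comes to rest. *)
Let progress m := exists T, [/\ m%:R <= T, ready (iter m f s0) T, covered T,
  jumps T & forall k, m = k.+1 -> exists2 t, Z t & k%:R <= t].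

Let at_rest := exists T, [/\ 0 <= T, covered T, jumps T &
  exists2 a, f a = a & forall t, T <= t -> S2 (x t) = a /\ ~ Z t].

Let progress_or_rest m : progress m \/ at_rest.
Proof.
elim: m => [|m [[T [mT rdy [r cov] jmp _]]|]]; last by right.
  left; exists 0; split=> //.
  - move=> i; have := start i; rewrite /p /q zE//; lra.
  - by exists [::] => t [t0 _]; rewrite leNgt t0.
  - by move=> t [t0 _]; rewrite leNgt t0.
have T0 : 0 <= T by exact: le_trans mT.
have stable : target_stable (iter m f s0) by move=> s' /s0_stepping.
have [fs|/eqP fs] := eqVneq (f (iter m f s0)) (iter m f s0).
  right; exists T; split=> //; first by exists r.
  exists (iter m f s0) => // t Tt.
  have pos i : 0 < sgn (f (iter m f s0) i) * p i t.
    have [/(_ _ t i Tt) H _] := stageP stable T0 rdy.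
    by apply: lt_le_trans (H _) => // j; rewrite /moving fs eqxx.
  split; first by apply/ffunP => i; rewrite S2E ?(le_trans T0)// (sgn_gt0 (pos i)) fs.
  by move=> [_ [i pi]]; have := pos i; rewrite pi mulr0 ltxx.
have [|T1 [TT1 rdy1 [r1 cov1] jmp1 [t Zt Tt]]] := stage_jumps stable T0 rdy fs.
  by move=> one; exact: (one m).
left; exists T1; split=> //.
- by rewrite -natr1; apply: le_trans TT1; rewrite lerD2r.
- exists (r ++ r1) => u Zu uT1; rewrite mem_cat; have [uT|Tu] := leP u T.
    by rewrite cov.
  by rewrite cov1 ?orbT// uT1 ltW.
- move=> u Zu uT1; have [uT|Tu] := leP u T; first exact: jmp.
  by apply: jmp1 => //; rewrite uT1 ltW.
- by move=> k [<-]; exists t => //; exact: le_trans Tt.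
Qed.

Let p0_neq0 i : p i 0 != 0.
Proof.
have [+ _] := start i; rewrite /p zE// => p0.
by apply: contraTneq p0 => ->; rewrite mulr0 -leNgt.
Qed.

Let no_zero a i : 0 <= a -> ~ Z a -> p i a != 0.
Proof.
rewrite le_eqVlt => /predU1P[<- _|a0 nZ]; first exact: p0_neq0.
by apply/eqP => pa; apply: nZ; split=> //; exists i.
Qed.

Let S2_const a b : 0 <= a <= b -> (forall t, a <= t <= b -> ~ Z t) ->
  S2 (x a) = S2 (x b).
Proof.
move=> /andP[a0 ab] nZ; apply/ffunP => i; rewrite !S2E//; last exact: le_trans ab.
have nz t : a <= t <= b -> p i t != 0.
  move=> /[dup] tI /nZ; apply: no_zero; apply: le_trans a0 _; by case/andP: tI.
have pc : {within `[a, b], continuous (p i)} by exact/continuous_subspaceT/p_cont.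
apply: contrapT => neq.
have [c] : exists2 c, c \in `[a, b] & p i c = 0.
  apply: IVT => //; have := nz a; have := nz b; rewrite !lexx ab.
  move=> /(_ isT) pb /(_ isT) pa; rewrite ge_min le_max; move: neq pa pb.
  rewrite !neq_lt => neq /orP[pa|pa] /orP[pb|pb]; rewrite ?(ltW pa) ?(ltW pb) ?orbT//.
    by case: neq; rewrite !ltNge (ltW pa) (ltW pb).
  by case: neq; rewrite pa pb.
by rewrite in_itv /= => cI pc0; have := nz c cI; rewrite pc0 eqxx.
Qed.

(** A nonzero coordinate has a fixed sign near [x t], so [x t] cannot be in both closures. *)
Let not_switching t : 0 <= t -> ~ Z t -> ~ switching_set M2 S2 (x t).
Proof.
move=> t0 nZ [i _ [[_ clo] clo']].
have := no_zero i t0 nZ; rewrite /p zE// neq_lt => /orP[neg|pos].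
  have /clo'[y [[My nSy] /= y0]] : nbhs (x t) [set y | y 0 (lshift n i) < 0].
    exact: (cvgr_lt _ (@coord_continuous _ _ _ 0 (lshift n i) (x t))).
  by apply: nSy; split=> //; rewrite ffunE; apply/negbTE; rewrite -leNgt ltW.
have /clo[y [[My Sy] /= y0]] : nbhs (x t) [set y | 0 < y 0 (lshift n i)].
  exact: (cvgr_gt _ (@coord_continuous _ _ _ 0 (lshift n i) (x t))).
by move: Sy; rewrite ffunE y0.
Qed.

Lemma trajectory_switching : exists K t, Defs.transversal M2 S2 x K t /\
  forall tau, let sx := boolean_sequence S2 x K t in
    (sx tau <> sx tau.+1 /\
     (forall i, sx tau.+1 i = f (sx tau) i \/ sx tau.+1 i = sx tau i) /\
     (one_stepping_trajectory f s0 -> sx tau.+1 = f (sx tau))) \/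
    (sx tau.+1 = sx tau /\ f (sx tau) = sx tau).
Proof.
have far (b : R) : exists m : nat, b < m%:R.
  by exists (Num.bound `|b|); exact: le_lt_trans (ler_norm b) (archi_boundP (normr_ge0 b)).
have upto b : covered b /\ jumps b.
  have [[T [T0 [r cov] jmp [a fa rest]]]|no] := pselect at_rest.
    have ZT t : Z t -> t <= T.
      by move=> Zt; rewrite leNgt; apply/negP => /ltW /rest[_].
    by split; [exists r => t Zt _; exact/cov/ZT|move=> t Zt _; exact/jmp/ZT].
  have [m bm] := far b; have [[T [mT _ [r cov] jmp _]]|//] := progress_or_rest m.
  have bT : b <= T by lra.
  split; first by exists r => t Zt tb; apply: cov => //; exact: le_trans bT.
  by move=> t Zt tb; apply: jmp => //; exact: le_trans bT.
apply: (@switching_sequence R _ n M2 S2 x f Z allowed).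
- by move=> t [].
- by move=> b; have [] := upto b.
- by move=> a b; exact: S2_const.
- by move=> t; exact: not_switching.
- by move=> t Zt; have [_] := upto t; apply.
move=> u u0 Zu t ut.
have [[T [T0 _ _ [a fa rest]]]|no] := pselect at_rest.
  suff -> : S2 (x t) = a by [].
  have [Tt|tT] := leP T t; first by case: (rest t Tt).
  have <- : S2 (x T) = a by case: (rest T (lexx T)).
  apply: S2_const => [|v vI /Zu]; lra.
(* Without rest there is a zero at time at least [m], beyond the supposed last one. *)
have [m um] := far u; have [[T [_ _ _ _ last]]|//] := progress_or_rest m.+1.
have [v /Zu vu mv] := last m erefl.
by have := le_lt_trans (le_trans mv vu) um; rewrite ltxx.
Qed.

End Trajectory.

(** * One-stepping trajectories and the open starting sets *)

Section StartSets.
Variables (R : realType) (n : nat).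

(** If a state and its successor differ in at most one coordinate, the only [s'] between them is the
    state itself, for which the condition is trivial. *)
Lemma one_stepping_monotone (f : state n -> state n) s :
  one_stepping_trajectory f s -> monotone_stepping_trajectory f s.
Proof.
move=> one tau s' [agree neq]; rewrite iterS.
suff -> : s' = iter tau f s by [].
have [i ni] : exists i, s' i != iter tau.+1 f s i.
  apply: contrapT => no; apply: neq; apply/ffunP => i; apply/eqP.
  by apply: contraT => ni; case: no; exists i.
have mi : iter tau f s i != iter tau.+1 f s i.
  by apply: contra_neq ni => e; rewrite -e -agree.
apply/ffunP => j; have [/agree//|mj] := eqVneq (iter tau f s j) (iter tau.+1 f s j).
have -> : j = i by apply: (card_le1_eqP (one tau)); rewrite inE.
by move: ni mi; case: (s' i); case: (iter tau f s i); case: (iter tau.+1 f s i).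
Qed.

(** The slow coordinates are constrained too, so that time 0 already has the initial form of a
    stage. *)
Definition start_cone (s : state n) : set 'rV[R]_(n + n) :=
  [set x | forall i, 1 < bsign R (s i) * x 0 (lshift n i) /\
                     1 < bsign R (s i) * x 0 (rshift n i)].

Lemma open_start_cone s : open (start_cone s).
Proof.
rewrite openE => x xs; rewrite /interior.
apply: (@filter_forall _ _ (fun i (y : 'rV[R]_(n + n)) =>
  1 < bsign R (s i) * y 0 (lshift n i) /\
  1 < bsign R (s i) * y 0 (rshift n i)) (nbhs x)) => i.
have cont j : bsign R (s i) * y 0 j @[y --> x] --> bsign R (s i) * x 0 j.
  by apply: cvgM; [exact: cvg_cst|exact: coord_continuous].
by apply: filterI; apply: cvgr_gt (cont _) _ _; have [] := xs i.
Qed.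

Lemma start_cone_nonempty s : M2 `&` start_cone s !=set0.
Proof.
have := xminus_bounds R => xb.
pose v : 'rV[R]_n := \row_i (2 * bsign R (s i)).
exists (row_mx v v); split=> [j|i].
  by rewrite /xplus mxE; case: splitP => k _; rewrite mxE /bsign; case: (s k); lra.
by rewrite row_mxEl row_mxEr !mxE /bsign; case: (s i); lra.
Qed.

Lemma start_cone_sub_W2 s : start_cone s `<=` W2 s.
Proof.
move=> x xs i; rewrite mxE; have [+ _] := xs i.
by rewrite /bsign; case: (s i); lra.
Qed.

Lemma S2_start_cone s x : start_cone s x -> S2 x = s.
Proof.
move=> xs; apply/ffunP => i; rewrite ffunE; have [+ _] := xs i; rewrite /bsign.
by case: (s i) => xi; [|apply/negbTE; rewrite -leNgt]; lra.
Qed.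

Lemma universal_start_cones :
  open_in M2 (\bigcup_s (M2 `&` start_cone s)) /\
  universal S2 (\bigcup_s (M2 `&` start_cone s)).
Proof.
split.
  exists (\bigcup_s start_cone s); last by rewrite setI_bigcupr.
  by apply: bigcup_open => s _; exact: open_start_cone.
apply/seteqP; split=> // s _; have [x xs] := start_cone_nonempty s.
by exists x; [exists s|apply: S2_start_cone xs.2].
Qed.

End StartSets.

Theorem theorem6 (R : realType) (n : nat) (n_ge1 : (1 <= n)%N)
    (f : state n -> state n) (Q : conversion_scheme R)
    (gamma_minus : 'rV[R]_n) (gamma_minus_gt0 : forall i, 0 < gamma_minus 0 i) :
  exists (mu : R) (U : state n -> set 'rV[R]_(n + n)),
    [/\ 0 < mu,
        forall s, [/\ open_in M2 (U s), U s !=set0 & U s `<=` W2 s] &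
        forall gamma : 'rV[R]_(n + n),
          lsubmx gamma = gamma_minus ->
          (forall j, 0 < gamma 0 j) ->
          (forall i : 'I_n, gamma 0 (rshift n i) < mu) ->
          [/\ forall s, monotone_stepping_trajectory f s ->
                consistent_on M2 S2 f (D2 gamma (Q n f)) (U s),
              forall s, one_stepping_trajectory f s ->
                strongly_consistent_on M2 S2 f (D2 gamma (Q n f)) (U s),
              monotone_stepping f ->
                consistent M2 S2 f (D2 gamma (Q n f)) &
              one_stepping f ->
                strongly_consistent M2 S2 f (D2 gamma (Q n f))]].
Proof.
have Qconv := conversionP Q f; have [_ Q01 _] := Qconv.
have [eta eta_bounds Qnear] := conversion_near_well Qconv.
(* The threshold on the slow rates depends on the fast ones only through this common lower bound. *)
have [gm [gm_gt0 gm_le]] : exists gm, 0 < gm /\ forall i, gm <= gamma_minus 0 i.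
  apply: (@filter_ex _ _ (at_right_proper_filter (0 : R))); apply: filterI.
    exact: nbhs_right_gt.
  apply: (@filter_forall _ _ (fun i g => g <= gamma_minus 0 i) ((0 : R)^'+)) => i.
  exact: nbhs_right_le.
exists (stage_mu n eta gm), (fun s => M2 `&` start_cone s); split.
- by apply: stage_mu_gt0 => //; case/andP: eta_bounds.
- move=> s; split; last by move=> x [_ /start_cone_sub_W2].
    by exists (start_cone s); [exact: open_start_cone|].
  exact: start_cone_nonempty.
move=> gamma gammaE gamma_gt0 gamma_lt.
have gamma_ge i : gm <= gamma 0 (lshift n i).
  by have := gm_le i; rewrite -gammaE mxE.
have switching s x xD := @trajectory_switching R n f (Q n f) gamma eta gm x
  Q01 eta_bounds Qnear gm_gt0 gamma_gt0 gamma_ge gamma_lt xD s.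
have cons s : monotone_stepping_trajectory f s ->
    consistent_on M2 S2 f (D2 gamma (Q n f)) (M2 `&` start_cone s).
  move=> mono x xD [_ xs]; have [K [t [tr moves]]] := switching s x xD mono xs.
  exists K, t; split=> //= tau; have [[neq [mv _]]|[eq fx]] := moves tau.
    split=> //; split=> [eq|fx]; first by case: neq; rewrite eq.
    by apply/ffunP => i; case: (mv i) => ->; rewrite ?fx.
  by split=> [i|]; [right; rewrite eq|split].
have scons s : one_stepping_trajectory f s ->
    strongly_consistent_on M2 S2 f (D2 gamma (Q n f)) (M2 `&` start_cone s).
  move=> one x xD [_ xs].
  have [K [t [tr moves]]] := switching s x xD (one_stepping_monotone one) xs.
  exists K, t; split=> //= tau; have [[_ [_ /(_ one)]]|[-> ->]] := moves tau => //.
have [U_open U_univ] := universal_start_cones R n.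
split=> // [mono|one]; exists (\bigcup_s (M2 `&` start_cone s)); split=> //.
  by move=> x xD [s _ xs]; apply: (cons s).
by move=> x xD [s _ xs]; apply: (scons s).
Qed.
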